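(* Let $E_{\frac13}$ be the elliptic curve defined by $$E_{\frac13}: y^2 = (x-1)\left(x^2+\tfrac13\right).$$ Then $$\frac{2\sqrt2}{3\pi}\cdot\Omega\left(E_{\frac13}\right) = \binom{\frac13}{\frac12}$$ and $$\sqrt2\cdot\Omega\left(E_{\frac13}\right) = \frac{\Gamma\left(\frac13\right)\Gamma\left(\frac12\right)}{\Gamma\left(\frac56\right)},$$ where $\Omega(E_{\frac13})$ is the real period of $E_{\frac13}$.
   Context: Binomial coefficient with rational arguments: $\displaystyle\binom{n}{k} = \frac{\Gamma(n+1)}{\Gamma(k+1)\,\Gamma(n-k+1)}$, where $\Gamma$ is the gamma function. Real period: for an elliptic curve $E$ written in the form $y^2 = 4x^3 - g_2x - g_3$ with $g_2,g_3\in\mathbb{R}$, let $\Lambda\subset\mathbb{C}$ be the period lattice such that $z\mapsto(\wp(z),\wp'(z),1)$ for $z\notin\Lambda$, $z\mapsto(0,1,0)$ for $z\in\Lambda$, gives a biholomorphic map $\mathbb{C}/\Lambda\to E(\mathbb{C})$, where $\wp$ is the Weierstrass $\wp$-function of $\Lambda$. Then $\Lambda$ can be written $\Lambda=\Omega(E)\mathbb{Z}+\Omega'(E)\mathbb{Z}$ with $\Omega(E)\in\mathbb{R}$ and $\Omega'(E)\in\mathbb{C}$; $\Omega(E)$, taken positive, is called the real period of $E$ (it is the positive generator of $\Lambda\cap\mathbb{R}$). For a curve $y^2=f(x)$ with $f$ a monic real cubic, such as $E_{\frac13}$, the real period is that of the curve $y^2=4f(x)$ obtained by replacing $y$ by $y/2$,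 with $x$ translated to remove the quadratic term of $f$. *)

(* Defs.v *)
From HB Require Import structures.
From mathcomp Require Import all_boot all_order all_algebra.
From mathcomp Require Import complex.
From mathcomp Require Import all_classical all_reals all_analysis.
From mathcomp Require summability.

Set Implicit Arguments.
Unset Strict Implicit.
Unset Printing Implicit Defensive.

Import Order.TTheory GRing.Theory Num.Theory.
Import numFieldNormedType.Exports.

Local Open Scope classical_set_scope.
Local Open Scope ring_scope.

(* R[i] as a one-dimensional normed space over itself, so that derivable and
   differentiable for functions of complex variables mean complex
   differentiability. *)
HB.instance Definition _ (R : realType) := GRing.ComAlgebra.copy R[i] R[i]^o.
HB.instance Definition _ (R : realType) := Vector.copy R[i] R[i]^o.
HB.instance Definition _ (R : realType) := NormedModule.copy R[i] R[i]^o.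

Section GammaFunction.
Variable R : realType.
Implicit Types x n k : R.

Definition Gamma_integral x : R :=
  \int[lebesgue_measure]_(t in `]0, +oo[) (t `^ (x - 1) * expR (- t)).

(* For x <= 0 the value is obtained by iterating Gamma (x + 1) = x * Gamma x
   until the argument is positive; at a pole the product vanishes, so the value
   is 0 and the reciprocal of Gamma has its usual value 0 there. *)
Definition Gamma x : R :=
  let m := if 0 < x then 0%N else (Num.truncn (- x)).+1 in
  Gamma_integral (x + m%:R) / \prod_(i < m) (x + i%:R).

Definition binomR n k : R :=
  Gamma (n + 1) / (Gamma (k + 1) * Gamma (n - k + 1)).

End GammaFunction.

Section RealPeriod.
Variable R : realType.
Local Notation C := R[i].
Local Notation "x %:C" := (x%:C%C : C).
Implicit Types (L : set C) (z w : C) (P Q : 'rV[C]_3).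

Definition int_span w1 w2 : set C :=
  [set z | exists m n : int, z = w1 *~ m + w2 *~ n].

Definition is_lattice L : Prop :=
  exists w1 w2,
    (forall a b : R, a%:C * w1 + b%:C * w2 = 0 -> a = 0 /\ b = 0) /\
    L = int_span w1 w2.

(* Sums over the lattice are unordered: limits along the finite subsets of C,
   the summand being extended by 0 outside L minus the origin. *)
Definition weierstrass_p L z : C :=
  z ^- 2 +
  summability.sum ((fun w => (z - w) ^- 2 - w ^- 2) \_ (L `\ (0 : C))).

(* The projective plane over C is represented by nonzero triples of homogeneous
   coordinates up to proj_eq. *)
Definition triple (x y t : C) : 'rV[C]_3 := \row_(i < 3) [:: x; y; t]`_i.

Definition proj_eq P Q : Prop := exists2 c : C, c != 0 & Q = c *: P.

(* Homogenization of y^2 = 4 x^3 - g2 x - g3, in coordinates (x : y : t). *)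
Definition on_curve (g2 g3 : R) P : Prop :=
  let x := P 0 (inord 0) in let y := P 0 (inord 1) in let t := P 0 (inord 2) in
  y ^+ 2 * t = 4 * x ^+ 3 - g2%:C * x * t ^+ 2 - g3%:C * t ^+ 3.

Definition weierstrass_map L z : 'rV[C]_3 :=
  if z \in L then triple 0 1 0
  else triple (weierstrass_p L z) (derive1 (weierstrass_p L) z) 1.

(* z |-> weierstrass_map L z maps C to the curve, factors through a bijection
   from C / L onto the points of the curve, is holomorphic into the projective
   plane (it has local holomorphic lifts to C^3) and has a holomorphic inverse:
   locally on the cone over the curve in C^3, the inverse is the restriction of
   a holomorphic function g of the three homogeneous coordinates. *)
Definition is_period_lattice (g2 g3 : R) L : Prop :=
  let phi := weierstrass_map L in
  [/\ is_lattice L,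
      forall z, on_curve g2 g3 (phi z),
      forall z w, proj_eq (phi z) (phi w) <-> L (z - w),
      forall P, P != 0 -> on_curve g2 g3 P -> exists z, proj_eq (phi z) P &
      (forall z0, exists psi : C -> 'rV[C]_3, \forall z \near z0,
        differentiable psi z /\ proj_eq (psi z) (phi z)) /\
      (forall P0, P0 != 0 -> on_curve g2 g3 P0 ->
        exists g : 'rV[C]_3 -> C, \forall P \near P0,
          differentiable g P /\ (on_curve g2 g3 P -> proj_eq (phi (g P)) P))].

(* Omega is the real period of y^2 = 4 x^3 - g2 x - g3; as L has rank 2, w' is
   not real and Omega is the positive generator of the real elements of L. *)
Definition is_real_period (g2 g3 Omega : R) : Prop :=
  exists L, [/\ is_period_lattice g2 g3 L, 0 < Omega &
                exists w' : C, L = int_span Omega%:C w'].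

(* Omega is the real period of y^2 = f(x), with f a monic cubic: replacing y by
   y / 2 and x by x - f_2 / 3 gives y^2 = 4 x^3 - g2 x - g3. *)
Definition is_real_period_monic (f : {poly R}) (Omega : R) : Prop :=
  exists g2 g3 : R,
    4 *: (f \Po ('X - (f`_2 / 3)%:P)) = 4 *: 'X^3 - g2 *: 'X - g3%:P /\
    is_real_period g2 g3 Omega.

End RealPeriod.

(* Right-hand side of the equation y^2 = (x - 1) (x^2 + 1/3). *)
Definition E_third (R : realType) : {poly R} :=
  ('X - 1) * ('X^2 + (1 / 3)%:P).

(* Main.v *)
(* The Weierstrass equation is [y^2 = 4 x^3 - 32/27], with [g2 = 0]. By the
   local holomorphic lifts of the Weierstrass map, [u = wp / wp'] and [v = 1 / wp']
   are analytic wherever [wp'] does not vanish, lattice points included, and solve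
   the polynomial system [u' = -1/2 - (3/2) g3 v^2], [v' = -6 u^2]. Along the real
   axis from the origin they stay real, since their imaginary parts solve a linear
   system with zero initial data, and [v] decreases; as [v] vanishes at [0] and at
   [Omega], [wp'] has a first zero [S], and [wp] decreases from [+oo] to the real
   root [2/3] on [(0, S)]. The same holds in the negative direction, with a zero
   [- S']. Injectivity of the Weierstrass map modulo the lattice gives
   [S + S' = Omega], and both are the time the flow [wp'] needs from [+oo] to [2/3].
   A 3-isogeny turns that time into the Beta integral
   [B(1/3, 1/2) / (2 sqrt 2)], which is evaluated by Tonelli's theorem. *)
Require Import Defs.
From mathcomp Require Import all_boot all_order all_algebra.
From mathcomp Require Import complex.
From mathcomp Require Import all_classical all_reals all_analysis.
From mathcomp Require Import measurable_realfun ftc.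
From mathcomp Require Import zify ring lra.

Set Implicit Arguments.
Unset Strict Implicit.
Unset Printing Implicit Defensive.

Import Order.TTheory GRing.Theory Num.Theory.
Import numFieldNormedType.Exports.
Local Open Scope classical_set_scope.
Local Open Scope ring_scope.

(** * Local lifts and differentiation along the real line *)

(** Ratios of homogeneous coordinates do not see the scalar [c], so near [z0] those of [phi] agree
    with those of the differentiable lift [psi]. *)
Lemma ratio_lift (K : numFieldType) (n : nat) (phi psi : K -> 'rV[K]_n)
    (j k : 'I_n) (z0 : K) :
  (\forall z \near z0,
    differentiable psi z /\ exists2 c : K, c != 0 & phi z = c *: psi z) ->
  phi z0 0 j != 0 ->
  (\forall z \near z0, phi z 0 j != 0) /\
  derivable (fun z => phi z 0 k / phi z 0 j) z0 1.
Proof.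
move=> psiP j0.
have dpsi i : derivable (fun z => psi z 0 i) z0 1.
  apply/derivable1_diffP; have [dp _] := nbhs_singleton psiP.
  have -> : (fun z => psi z 0 i) = (fun N : 'rV_n => N 0 i) \o psi.
    by [].
  apply: differentiable_comp => //.
  exact: differentiable_coord.
have nzE z : (exists2 c : K, c != 0 & phi z = c *: psi z) ->
    (psi z 0 j != 0) = (phi z 0 j != 0).
  by case=> c c0 ->; rewrite mxE mulf_eq0 (negbTE c0).
have psi0 : psi z0 0 j != 0.
  by rewrite nzE//; case: (nbhs_singleton psiP).
have cpsi : {for z0, continuous (fun z => psi z 0 j)}.
  by apply: differentiable_continuous; exact/derivable1_diffP.
have near_psi : \forall z \near z0, psi z 0 j != 0.
  exact: (cvgr_neq0 _ cpsi psi0).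
split.
  near=> z; rewrite -nzE; first by near: z.
  have : differentiable psi z /\ exists2 c : K, c != 0 & phi z = c *: psi z.
    by near: z.
  by case.
apply: (@near_eq_derivable _ _ _
  (fun z => psi z 0 k * (psi z 0 j)^-1)).
  near=> z; have [_ [c c0 E]] : differentiable psi z /\
    exists2 c : K, c != 0 & phi z = c *: psi z by near: z; exact: psiP.
  by rewrite E !mxE -mulf_div divff// mul1r.
by apply: derivableM => //; exact: derivableV.
Unshelve. all: by end_near. Qed.

Definition wmap_coord (R : realType) (L : set R[i]) (k : nat) (z : R[i]) : R[i] :=
  weierstrass_map L z 0 (inord k).

Lemma wmap_coordE (R : realType) (L : set R[i]) (k : nat) (z : R[i]) :
  (k < 3)%N -> wmap_coord L k z =
  (if z \in L then [:: 0; 1; 0]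
   else [:: weierstrass_p L z; derive1 (weierstrass_p L) z; 1])`_k.
Proof.
by move=> k3; rewrite /wmap_coord /weierstrass_map; case: ifP => _;
  rewrite mxE inordK.
Qed.

(** The case [j = 1] covers lattice points, where [wp] has a pole but coordinate [1] equals [1]; the
    case [j = 2] covers the points off the lattice. *)
Lemma wmap_coord_ratio (R : realType) (g2 g3 : R) (L : set R[i]) (j k : nat)
    (z0 : R[i]) : is_period_lattice g2 g3 L -> wmap_coord L j z0 != 0 ->
  (\forall z \near z0, wmap_coord L j z != 0) /\
  derivable (fun z => wmap_coord L k z / wmap_coord L j z) z0 1.
Proof.
case=> _ _ _ _ [/(_ z0)[psi psiP] _] j0.
exact: (@ratio_lift R[i] 3 (weierstrass_map L) psi (inord j) (inord k) z0 psiP j0).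
Qed.

Lemma is_derive_epsdelta (K : numFieldType) (f : K -> K) (z d : K) :
  is_derive z 1 f d -> forall e : K, 0 < e -> exists2 r : K, 0 < r &
  forall h, h != 0 -> `|h| < r -> `|d - (f (h + z) - f z) / h| < e.
Proof.
move=> [df <-] e e0; rewrite /derive.
have := df; rewrite /derivable => /cvgrPdist_lt/(_ e e0).
move=> /nbhs_ballP[r /= r0 rP].
exists r => // h h0 hr; have := rP h.
rewrite -ball_normE /= sub0r normrN => /(_ hr h0).
by rewrite /= [_%:A]mulr1 mulrC.
Qed.

(** Differentiating the cubic gives [2 p' p'' = 12 p^2 p'], hence [p'' = 6 p^2] where [p'] does not
    vanish. Both formulas follow by the quotient rule, the first after using the cubic once more. *)
Lemma weierstrass_derive (K : numFieldType) (p : K -> K) (g3 z0 : K) :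
  (\forall z \near z0, derivable p z 1) -> derivable (derive1 p) z0 1 ->
  (\forall z \near z0, derive1 p z ^+ 2 = 4 * p z ^+ 3 - g3) ->
  derive1 p z0 != 0 ->
  is_derive z0 1 (fun z => p z / derive1 p z)
    (- 2^-1 - 3 / 2 * g3 * (derive1 p z0)^-1 ^+ 2) /\
  is_derive z0 1 (fun z => (derive1 p z)^-1) (- 6 * (p z0 / derive1 p z0) ^+ 2).
Proof.
move=> dp dq pq q0; set q := derive1 p in dq pq q0 *.
have dp0 : is_derive z0 1 p (q z0).
  by rewrite /q derive1E; apply/derivableP/(nbhs_singleton dp).
have dq0 : is_derive z0 1 q ('D_1 q z0) by exact/derivableP.
have qE : 'D_1 q z0 = 6 * p z0 ^+ 2.
  have d1 : is_derive z0 1 (q ^+ 2) (2 * q z0 * 'D_1 q z0).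
    by apply: is_derive_eq; rewrite /GRing.scale /= expr1 mulr_natl.
  have d2 : is_derive z0 1 (cst 4 * p ^+ 3 - cst g3) (12 * p z0 ^+ 2 * q z0).
    by apply: is_derive_eq; rewrite /GRing.scale /= mulr0 addr0 subr0; ring.
  have d3 : is_derive z0 1 (q ^+ 2) (12 * p z0 ^+ 2 * q z0).
    apply: near_eq_is_derive d2.
    by near=> z; rewrite !fctE; symmetry; near: z; exact: pq.
  have : 2 * q z0 * 'D_1 q z0 = 12 * p z0 ^+ 2 * q z0.
    by case: d1 => _ <-; case: d3 => _ <-.
  move=> E; apply: (mulfI q0); apply: (@mulfI _ 2) => //.
  by rewrite mulrA E; ring.
have dV : is_derive z0 1 (fun z => (q z)^-1) (- (q z0) ^- 2 * 'D_1 q z0).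
  by apply: DeriveDef; [exact: derivableV | rewrite deriveV].
split.
  have dU : is_derive z0 1 (p * (fun z => (q z)^-1))
     (p z0 * (- (q z0) ^- 2 * 'D_1 q z0) + (q z0)^-1 * q z0).
    by apply: is_derive_eq.
  apply: is_derive_eq; rewrite qE.
  have /nbhs_singleton E := pq.
  have -> : g3 = 4 * p z0 ^+ 3 - q z0 ^+ 2 by rewrite E; ring.
  by field.
apply: is_derive_eq; rewrite qE; by field.
Unshelve. all: by end_near. Qed.

Lemma ReZr (R : realType) (x : R[i]) (a : R) :
  complex.Re (x * a%:C%C) = complex.Re x * a.
Proof. by case: x => u v /=; ring. Qed.

Lemma ImZr (R : realType) (x : R[i]) (a : R) :
  complex.Im (x * a%:C%C) = complex.Im x * a.
Proof. by case: x => u v /=; ring. Qed.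

Lemma normc_ge_Im (R : realType) (x : R[i]) : `|complex.Im x|%:C%C <= `|x|.
Proof.
case: x => a b /=; rewrite normc_def lecR /=.
by rewrite -sqrtr_sqr ler_sqrt ?lerDr ?sqr_ge0// addr_ge0 ?sqr_ge0.
Qed.

Lemma real_normc (R : realType) (a : R) : `|a%:C%C| = `|a|%:C%C :> R[i].
Proof. by rewrite normc_def /= expr0n /= addr0 sqrtr_sqr. Qed.

Lemma realc_gt0 (R : realType) (r : R[i]) : 0 < r ->
  exists2 s : R, 0 < s & r = s%:C%C.
Proof.
by case: r => a b; rewrite ltcE /= => /andP[/eqP -> a0]; exists a.
Qed.

(** [g] stands for the real or the imaginary part. It commutes with division by real increments and
    does not enlarge the error of the complex difference quotient. *)
Lemma is_derive_real_line (R : realType) (f : R[i] -> R[i]) (t : R) (d : R[i])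
    (g : R[i] -> R) :
  (forall x y : R[i], g (x - y) = g x - g y) ->
  (forall (x : R[i]) (a : R), g (x * a%:C%C) = g x * a) ->
  (forall x : R[i], `|g x|%:C%C <= `|x|) ->
  is_derive t%:C%C 1 f d ->
  is_derive t 1 (fun s : R => g (f s%:C%C)) (g d).
Proof.
move=> gB gZ g_le fd.
have key : h^-1 *: (g (f (h *: 1 + t)%:C%C) - g (f t%:C%C)) @[h --> 0^'] --> g d.
  apply/cvgrPdist_lt => e e0.
  have eC : 0 < e%:C%C :> R[i] by rewrite ltcR.
  have [r /realc_gt0[s s0 ->] H] := is_derive_epsdelta fd eC.
  near=> h.
  have h0 : h != 0 by near: h; exact: nbhs_dnbhs_neq.
  have hs : `|h| < s.
    by near: h; apply: dnbhs0_lt.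
  have := H h%:C%C; rewrite real_normc ltcR => /(_ _ hs).
  have -> : h%:C%C != 0 :> R[i] by rewrite eq_complex /= eqxx andbT.
  move=> /(_ isT); rewrite -rmorphD -fmorphV.
  move=> /(le_lt_trans (g_le _)); rewrite ltcR gB gZ gB.
  by rewrite /GRing.scale /= mulr1 mulrC.
apply: DeriveDef; last exact/cvg_lim.
by apply/cvg_ex; exists (g d).
Unshelve. all: by end_near. Qed.

Lemma is_derive_ReIm (R : realType) (f : R[i] -> R[i]) (t : R) (d : R[i]) :
  is_derive t%:C%C 1 f d ->
  is_derive t 1 (fun s : R => complex.Re (f s%:C%C)) (complex.Re d) /\
  is_derive t 1 (fun s : R => complex.Im (f s%:C%C)) (complex.Im d).
Proof.
move=> fd; split; apply: (is_derive_real_line _ _ _ fd).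
- by move=> [? ?] [? ?].
- exact: ReZr.
- exact: normc_ge_Re.
- by move=> [? ?] [? ?].
- exact: ImZr.
- exact: normc_ge_Im.
Qed.

Lemma near_real_line (R : realType) (P : R[i] -> Prop) (t : R) :
  (\forall z \near t%:C%C, P z) -> \forall s \near t, P s%:C%C.
Proof.
move=> /nbhs_ballP[r /= /realc_gt0[s s0 ->] rP].
apply/nbhs_ballP; exists s => // u; rewrite /= -!ball_normE /= => us.
by apply: rP; rewrite -ball_normE /= -rmorphB real_normc ltcR.
Qed.

(** * The Weierstrass map on the real axis *)

(** A lattice has a basis independent over the reals, so [w'] cannot be real; the imaginary part of
    a real element then forces the coefficient of [w'] to be zero. *)
Lemma int_span_real (R : realType) (Om : R) (w' : R[i]) (t : R) :
  is_lattice (int_span Om%:C%C w') ->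
  int_span Om%:C%C w' t%:C%C <-> exists m : int, t = m%:~R * Om.
Proof.
move=> [w1 [w2 [ind LE]]].
have ImN0 : complex.Im w' != 0.
  apply/eqP => w'0.
  have real z : int_span Om%:C%C w' z -> complex.Im z = 0.
    by move=> [m [n ->]]; rewrite raddfD /= !raddfMz /= w'0 !mul0rz addr0.
  have w1r : complex.Im w1 = 0.
    by apply: real; rewrite LE; exists 1, 0; rewrite mulr1z mulr0z addr0.
  have w2r : complex.Im w2 = 0.
    by apply: real; rewrite LE; exists 0, 1; rewrite mulr1z mulr0z add0r.
  move: ind w1r w2r; case: w1 {LE} => u u'; case: w2 => v v' /= ind u'0 v'0.
  rewrite u'0 v'0 in ind.
  (* [v * u - u * v = 0] is a real relation between [w1 = u] and [w2 = v]. Independence makes both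
     vanish, and then [1, 0] is a nontrivial relation. *)
  have [v0 u0] : v = 0 /\ - u = 0.
    by apply: ind; apply/eqP; rewrite eq_complex /=; apply/andP; split; apply/eqP; ring.
  move/eqP : u0; rewrite oppr_eq0 => /eqP u0.
  have [|/eqP] := ind 1 0; last by rewrite oner_eq0.
  by rewrite u0 v0; apply/eqP; rewrite eq_complex /=; apply/andP; split; apply/eqP; ring.
split=> [[m [n E]]|[m ->]]; last first.
  by exists m, 0; rewrite mulr0z addr0 mulrzl raddfMz.
have /esym/eqP := congr1 (@complex.Im R) E.
rewrite raddfD /= !raddfMz /= mul0rz add0r -mulrzl mulf_eq0 (negbTE ImN0) orbF.
rewrite intr_eq0 => /eqP n0; exists m.
have := congr1 (@complex.Re R) E.
by rewrite n0 mulr0z addr0 raddfMz /= mulrzl.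
Qed.

Lemma wmap_coord_in (R : realType) (L : set R[i]) (z : R[i]) : L z ->
  [/\ wmap_coord L 0 z = 0, wmap_coord L 1 z = 1 & wmap_coord L 2 z = 0].
Proof. by move=> /mem_set zL; rewrite !wmap_coordE// zL. Qed.

Lemma wmap_coord_out (R : realType) (L : set R[i]) (z : R[i]) : ~ L z ->
  [/\ wmap_coord L 0 z = weierstrass_p L z,
      wmap_coord L 1 z = derive1 (weierstrass_p L) z & wmap_coord L 2 z = 1].
Proof. by move=> zL; rewrite !wmap_coordE// (memNset zL). Qed.

Lemma wmap_coord2_neq0 (R : realType) (L : set R[i]) (z : R[i]) :
  wmap_coord L 2 z != 0 -> ~ L z.
Proof. by move=> z2 /wmap_coord_in[_ _ E]; rewrite E eqxx in z2. Qed.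

Lemma wmap_cubic (R : realType) (g3 : R) (L : set R[i]) (z : R[i]) :
  is_period_lattice 0 g3 L ->
  wmap_coord L 1 z ^+ 2 * wmap_coord L 2 z =
  4 * wmap_coord L 0 z ^+ 3 - g3%:C%C * wmap_coord L 2 z ^+ 3.
Proof.
move=> [_ /(_ z) + _ _ _]; rewrite /on_curve /= -/(wmap_coord L 0 z).
rewrite -/(wmap_coord L 1 z) -/(wmap_coord L 2 z) => ->.
by rewrite rmorph0 !mul0r subr0.
Qed.

(** Coordinate [2] is [1] off the lattice and [0] on it, and its nonvanishing is an open
    condition. *)
Lemma near_not_lattice (R : realType) (g2 g3 : R) (L : set R[i]) (z0 : R[i]) :
  is_period_lattice g2 g3 L -> ~ L z0 -> \forall z \near z0, ~ L z.
Proof.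
move=> HL z0L; have [_ _ E] := wmap_coord_out z0L.
have z2 : wmap_coord L 2 z0 != 0 by rewrite E oner_eq0.
have [N _] := wmap_coord_ratio 0 HL z2.
by apply: filterS N => z; exact: wmap_coord2_neq0.
Qed.

(** Off the lattice [wp] and its derivative are the ratios over coordinate [2], so their regularity
    comes from the lifts and not from the lattice sum. *)
Lemma wp_derivable (R : realType) (g2 g3 : R) (L : set R[i]) (z0 : R[i]) :
  is_period_lattice g2 g3 L -> ~ L z0 ->
  derivable (weierstrass_p L) z0 1 /\ derivable (derive1 (weierstrass_p L)) z0 1.
Proof.
move=> HL z0L; have [_ _ E] := wmap_coord_out z0L.
have z2 : wmap_coord L 2 z0 != 0 by rewrite E oner_eq0.
have [_ D0] := wmap_coord_ratio 0 HL z2.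
have [_ D1] := wmap_coord_ratio 1 HL z2.
split; [apply: near_eq_derivable D0|apply: near_eq_derivable D1];
  apply: filterS (near_not_lattice HL z0L) => z zL;
  by have [E0 E1 E2] := wmap_coord_out zL; rewrite ?E0 ?E1 E2 divr1.
Qed.

Lemma wmap_derive (R : realType) (g3 : R) (L : set R[i]) (z0 : R[i]) :
  is_period_lattice 0 g3 L -> ~ L z0 -> wmap_coord L 1 z0 != 0 ->
  is_derive z0 1 (fun z => wmap_coord L 0 z / wmap_coord L 1 z)
    (- 2^-1 - 3 / 2 * g3%:C%C * (wmap_coord L 2 z0 / wmap_coord L 1 z0) ^+ 2) /\
  is_derive z0 1 (fun z => wmap_coord L 2 z / wmap_coord L 1 z)
    (- 6 * (wmap_coord L 0 z0 / wmap_coord L 1 z0) ^+ 2).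
Proof.
move=> HL z0L; have NL := near_not_lattice HL z0L.
have [-> -> ->] := wmap_coord_out z0L => q0; rewrite div1r.
have dp : \forall z \near z0, derivable (weierstrass_p L) z 1.
  by apply: filterS NL => z zL; case: (wp_derivable HL zL).
have [_ dq] := wp_derivable HL z0L.
have pq : \forall z \near z0, derive1 (weierstrass_p L) z ^+ 2 =
    4 * weierstrass_p L z ^+ 3 - g3%:C%C.
  apply: filterS NL => z zL; have := wmap_cubic z HL.
  by have [-> -> ->] := wmap_coord_out zL; rewrite !(expr1n, mulr1).
have [dU dV] := @weierstrass_derive R[i] (weierstrass_p L) g3%:C%C z0 dp dq pq q0.
split; [apply: near_eq_is_derive dU|apply: near_eq_is_derive dV];
  apply: filterS NL => z zL;
  by have [E0 E1 E2] := wmap_coord_out zL; rewrite ?E0 E1 ?E2 ?div1r.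
Qed.

Lemma is_derive_mull (R : realType) (e t : R) :
  is_derive t (1 : R) (fun s : R => e * s) e.
Proof. by apply: is_derive_eq; rewrite /GRing.scale /= mulr1. Qed.

Lemma derivable_axis_continuous (R : realType) (f : R[i] -> R[i]) (e t : R) :
  derivable f (e * t)%:C%C 1 ->
  {for t, continuous (fun s : R => complex.Re (f (e * s)%:C%C))} /\
  {for t, continuous (fun s : R => complex.Im (f (e * s)%:C%C))}.
Proof.
move=> /derivableP/is_derive_ReIm[dR dI].
split; apply: differentiable_continuous; apply/derivable1_diffP.
  by have [] := is_derive1_comp dR (is_derive_mull e t).
by have [] := is_derive1_comp dI (is_derive_mull e t).
Qed.

(** The chain rule contributes one factor [e], which cancels the sign in front. *)
Lemma is_derive_axis (R : realType) (f : R[i] -> R[i]) (e t : R) (D : R[i]) :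
  e * e = 1 -> is_derive (e * t)%:C%C 1 f D ->
  is_derive t (1 : R) (fun s : R => e * complex.Re (f (e * s)%:C%C)) (complex.Re D) /\
  is_derive t (1 : R) (fun s : R => e * complex.Im (f (e * s)%:C%C)) (complex.Im D).
Proof.
move=> ee /is_derive_ReIm[dR dI]; split.
  have h := is_deriveM (is_derive_cst e t (1 : R)) (is_derive1_comp dR (is_derive_mull e t)).
  apply: (is_derive_eq h); rewrite /GRing.scale /= mulr0 addr0 mulrCA ee mulr1 //.
have h := is_deriveM (is_derive_cst e t (1 : R)) (is_derive1_comp dI (is_derive_mull e t)).
apply: (is_derive_eq h); rewrite /GRing.scale /= mulr0 addr0 mulrCA ee mulr1 //.
Qed.

Lemma near_axis (R : realType) (P : R[i] -> Prop) (e t : R) :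
  (\forall z \near (e * t)%:C%C, P z) -> \forall s \near t, P (e * s)%:C%C.
Proof. by move=> /near_real_line; exact: (@mulrl_continuous _ e t). Qed.

Lemma real_eq_complex (R : realType) (z : R[i]) : complex.Im z = 0 ->
  z = (complex.Re z)%:C%C.
Proof. by case: z => u v /= ->. Qed.

Lemma complex_sqr (R : realType) (u v : R) :
  (Complex u v) ^+ 2 = Complex (u ^+ 2 - v ^+ 2) (2 * u * v).
Proof. by rewrite expr2; apply/eqP; rewrite eq_complex /=; apply/andP; split; apply/eqP; ring. Qed.

Lemma scale_complex (R : realType) (k u v : R) :
  k%:C%C * Complex u v = Complex (k * u) (k * v).
Proof. by apply/eqP; rewrite eq_complex /=; apply/andP; split; apply/eqP; ring. Qed.

(* Along a real axis, [a + i b] stands for [wp / wp'], [c + i d] for [1 / wp']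
   (both analytic near the lattice points, where they vanish), [x + i y] for [wp],
   and [G] for the complement of the zeros of [wp'], lattice points included. *)
Record real_axis_flow (R : realType) (g3 Om : R) (G : set R)
    (a b c d x y : R -> R) : Prop := RealAxisFlow {
  flow_gt0 : 0 < Om;
  flow_open : forall t : R, G t -> \forall s \near t, G s;
  flow_start : [/\ G 0, a 0 = 0, b 0 = 0, c 0 = 0 & d 0 = 0];
  flow_end : G Om /\ c Om = 0;
  flow_cont : forall t : R, G t ->
    [/\ {for t, continuous a}, {for t, continuous b},
        {for t, continuous c} & {for t, continuous d}];
  flow_ode : forall t : R, 0 < t < Om -> G t ->
    [/\ is_derive t 1 a (- 2^-1 - 3 / 2 * g3 * (c t ^+ 2 - d t ^+ 2)),
        is_derive t 1 b (- 3 * g3 * c t * d t),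
        is_derive t 1 c (- 6 * (a t ^+ 2 - b t ^+ 2)) &
        is_derive t 1 d (- 12 * a t * b t)];
  flow_neq0 : forall t : R, 0 < t < Om -> G t -> c t != 0 \/ d t != 0;
  flow_cubic : forall t : R, G t -> b t = 0 -> d t = 0 ->
    c t = 4 * a t ^+ 3 - g3 * c t ^+ 3;
  flow_affine : forall t : R, 0 < t < Om -> G t -> b t = 0 -> d t = 0 ->
    x t = a t / c t /\ y t = 0;
  flow_crit : forall t : R, 0 < t < Om -> ~ G t ->
    [/\ {for t, continuous x}, {for t, continuous y} &
        y t = 0 -> 4 * x t ^+ 3 = g3]
}.

(* [e] is a sign: the system is invariant under [u(t), v(t)] |-> [- u(- t), - v(- t)],
   so both half-axes give a flow of the same kind. *)
Lemma wmap_flow (R : realType) (g3 Om e : R) (L : set R[i]) (w' : R[i]) :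
  is_period_lattice 0 g3 L -> 0 < Om -> L = int_span Om%:C%C w' -> e * e = 1 ->
  let U z := wmap_coord L 0 z / wmap_coord L 1 z in
  let V z := wmap_coord L 2 z / wmap_coord L 1 z in
  real_axis_flow g3 Om
    [set t : R | wmap_coord L 1 (e * t)%:C%C != 0]
    (fun t => e * complex.Re (U (e * t)%:C%C))
    (fun t => e * complex.Im (U (e * t)%:C%C))
    (fun t => e * complex.Re (V (e * t)%:C%C))
    (fun t => e * complex.Im (V (e * t)%:C%C))
    (fun t => complex.Re (weierstrass_p L (e * t)%:C%C))
    (fun t => complex.Im (weierstrass_p L (e * t)%:C%C)).
Proof.
move=> HL Om0 LE ee U V.
have Llat : is_lattice (int_span Om%:C%C w') by rewrite -LE; case: HL.
have Lreal (t : R) : L t%:C%C <-> exists m : int, t = m%:~R * Om.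
  by rewrite LE; exact: int_span_real.
have e0 : e != 0 by apply/eqP => E; move/eqP: ee; rewrite E mul0r eq_sym oner_eq0.
have e1 : `|e| = 1.
  by apply/eqP; rewrite -sqrp_eq1// -normrX expr2 ee normr1.
(* [e * t] has absolute value strictly between [0] and [Om], while a nonzero multiple of [Om] has
   absolute value at least [Om]. *)
have outL (t : R) : 0 < t < Om -> ~ L (e * t)%:C%C.
  move=> /andP[t0 tOm] /Lreal[m E].
  have := congr1 Num.norm E.
  rewrite !normrM e1 mul1r (gtr0_norm t0) (gtr0_norm Om0) -intr_norm => nE.
  have m0 : (0 < `|m|)%R.
    by rewrite -(ltr0z R) -(pmulr_lgt0 _ Om0) -nE.
  rewrite gtz0_ge1 in m0; move: tOm; rewrite nE gtr_pMl// ltrz1 => h.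
  by move: (lt_le_trans h m0); rewrite ltxx.
have L0 : L (e * 0)%:C%C by apply/Lreal; exists 0; rewrite mulr0 mul0r.
have LOm : L (e * Om)%:C%C.
  apply/Lreal; have : (e == 1) || (e == -1) by rewrite -sqrf_eq1 expr2 ee.
  by move=> /orP[] /eqP ->; [exists 1|exists (-1)]; rewrite ?rmorphN.
have coordOut := fun t tOm => wmap_coord_out (outL t tOm).
have VN (t : R) : 0 < t < Om -> wmap_coord L 1 (e * t)%:C%C != 0 ->
    V (e * t)%:C%C != 0.
  by move=> tOm Gt; have [_ _ E2] := coordOut t tOm; rewrite /V E2 div1r invr_neq0.
have C4 : 4 = (4 : R)%:C%C :> R[i] by rewrite rmorph_nat.
split.
- exact: Om0.
- move=> t Gt; have [N _] := wmap_coord_ratio 0 HL Gt.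
  exact: (@near_axis _ (fun z => wmap_coord L 1 z != 0) e t N).
- have [E0 E1 E2] := wmap_coord_in L0; rewrite /= /U /V E0 E1 E2 !mul0r /= !mulr0.
  by split=> //; exact: oner_neq0.
- have [E0 E1 E2] := wmap_coord_in LOm; rewrite /= /U /V E1 E2 !mul0r /= mulr0.
  by split=> //; exact: oner_neq0.
- move=> t Gt.
  have [_ /derivable_axis_continuous[c1 c2]] := wmap_coord_ratio 0 HL Gt.
  have [_ /derivable_axis_continuous[c3 c4]] := wmap_coord_ratio 2 HL Gt.
  by split; apply: cvgMr.
- move=> t tOm Gt.
  have [dU dV] := wmap_derive HL (outL t tOm) Gt.
  have [dUR dUI] := is_derive_axis ee dU.
  have [dVR dVI] := is_derive_axis ee dV.
  have DU X : - 2^-1 - 3 / 2 * g3%:C%C * X = (- 2^-1)%:C%C + (- (3 / 2 * g3))%:C%C * X.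
    by rewrite !(rmorphN, rmorphM, fmorphV, rmorph_nat) mulNr.
  have DV X : - 6 * X = (- 6)%:C%C * X :> R[i] by rewrite rmorphN rmorph_nat.
  rewrite -/(U _) in dVR dVI; rewrite -/(V _) in dUR dUI.
  split.
  + apply: (is_derive_eq dUR); rewrite DU; case: (V _) => u v.
    by rewrite complex_sqr scale_complex /= !exprMn [e ^+ 2]expr2 ee; ring.
  + apply: (is_derive_eq dUI); rewrite DU; case: (V _) => u v.
    by rewrite complex_sqr scale_complex /= -[LHS]mul1r -[X in X * _ = _]ee; field.
  + apply: (is_derive_eq dVR); rewrite DV; case: (U _) => u v.
    by rewrite complex_sqr scale_complex /= !exprMn [e ^+ 2]expr2 ee; ring.
  + apply: (is_derive_eq dVI); rewrite DV; case: (U _) => u v.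
    by rewrite complex_sqr scale_complex /= -[LHS]mul1r -[X in X * _ = _]ee; field.
- move=> t tOm Gt; have := VN t tOm Gt; case: (V _) => u v /=.
  rewrite eq_complex /= negb_and => /orP[] h; [left|right]; exact: mulf_neq0.
- move=> t Gt /eqP; rewrite mulf_eq0 (negbTE e0) /= => /eqP bU /eqP.
  rewrite mulf_eq0 (negbTE e0) /= => /eqP dV.
  (* This is the homogeneous cubic divided by the cube of coordinate [1]. *)
  have : V (e * t)%:C%C = 4 * U (e * t)%:C%C ^+ 3 - g3%:C%C * V (e * t)%:C%C ^+ 3.
    have := wmap_cubic (e * t)%:C%C HL; rewrite /U /V.
    move: Gt; rewrite /=; set X := wmap_coord L 0 _; set Y := wmap_coord L 1 _.
    set Z := wmap_coord L 2 _ => Y0 E.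
    transitivity (Y ^+ 2 * Z / Y ^+ 3); first by field.
    by rewrite E; field.
  rewrite (real_eq_complex bU) (real_eq_complex dV) -!rmorphXn C4.
  rewrite -!rmorphM -rmorphB => /complexI /= E; rewrite {1}E.
  set u := complex.Re _; set v := complex.Re _.
  (* Only odd powers of [U] and [V] occur, so the sign [e] factors out. *)
  have e3 : e ^+ 3 = e by rewrite exprS expr2 ee mulr1.
  by rewrite !exprMn e3; ring.
- move=> t tOm Gt /eqP; rewrite mulf_eq0 (negbTE e0) /= => /eqP bU /eqP.
  rewrite mulf_eq0 (negbTE e0) /= => /eqP dV.
  have V0 := VN t tOm Gt.
  have : weierstrass_p L (e * t)%:C%C = U (e * t)%:C%C / V (e * t)%:C%C.
    rewrite /U /V; have [-> E1 ->] := coordOut t tOm; rewrite /= E1 in Gt *.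
    by field.
  move: V0; rewrite (real_eq_complex bU) (real_eq_complex dV) => V0 ->.
  have v0 : complex.Re (V (e * t)%:C%C) != 0.
    by apply: contraNneq V0 => ->.
  rewrite -fmorphV -rmorphM /=; split => //.
  by field; rewrite e0 v0.
(* Outside [G] the value [wp'] is zero, and the cubic reduces to [4 wp^3 = g3]. *)
- move=> t tOm /= /negP; rewrite negbK => /eqP q0.
  have [dp _] := wp_derivable HL (outL t tOm).
  have [c1 c2] := derivable_axis_continuous dp.
  split => // yt.
  have := wmap_cubic (e * t)%:C%C HL; rewrite q0.
  have [-> _ ->] := coordOut t tOm; rewrite (real_eq_complex yt).
  rewrite expr0n mul0r expr1n mulr1 -rmorphXn C4 -rmorphM -rmorphB.
  by move=> /esym/complexI/eqP; rewrite subr_eq0 => /eqP.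
Qed.

(** * The real flow up to its first critical point *)

Lemma is_derive_nonincreasing (R : realType) (f df : R -> R) (a b : R) :
  (forall t : R, a <= t <= b -> {for t, continuous f}) ->
  (forall t : R, a < t < b -> is_derive t 1 f (df t)) ->
  (forall t : R, a < t < b -> df t <= 0) ->
  forall x y : R, a <= x -> x <= y -> y <= b -> f y <= f x.
Proof.
move=> cf fdf df0 x y ax xy yb.
apply: (@ler0_derive1_le_cc _ f a b) => //.
- by move=> t; rewrite in_itv /= => /fdf[].
- by move=> t; rewrite in_itv /= => tab; rewrite derive1E; have [_ ->] := fdf t tab; exact: df0.
- apply: continuous_in_subspaceT => t; rewrite inE /= in_itv /=; exact: cf.
- by rewrite in_itv /= yb (le_trans ax xy).
- by rewrite in_itv /= ax (le_trans xy yb).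
Qed.

(* Gronwall: [b] and [d] solve a homogeneous linear system with bounded
   coefficients and vanish at [0]. *)
Lemma flow_real (R : realType) (g3 Om : R) (G : set R)
    (a b c d x y : R -> R) (T : R) :
  real_axis_flow g3 Om G a b c d x y -> 0 <= T <= Om ->
  (forall t : R, 0 <= t <= T -> G t) ->
  forall t : R, 0 <= t <= T -> b t = 0 /\ d t = 0.
Proof.
move=> F /andP[T0 TOm] GT t /andP[t0 tT].
(* The system gives [(b^2 + d^2)' = - 2 b d (3 g3 c + 12 a)], at most [h (b^2 + d^2)]; the maximum
   of [h] on [[0, T]] is the Gronwall constant [M]. *)
pose h (s : R) : R := `|3 * g3 * c s + 12 * a s|.
have [s0 _ sM] : exists2 s0, s0 \in `[0, T]%R &
    forall s : R, s \in `[0, T]%R -> h s <= h s0.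
  apply: EVT_max => //; apply: continuous_in_subspaceT => s.
  rewrite inE /= in_itv /= => /GT/(flow_cont F)[ca _ cc _].
  apply: (@continuous_comp _ _ _ (fun s => 3 * g3 * c s + 12 * a s)).
    by apply: cvgD; apply: cvgMr.
  exact: norm_continuous.
pose M : R := h s0.
pose N : R -> R := (b * b + d * d) * (expR \o (fun s : R => - M * s)).
have dE (s : R) : is_derive s (1 : R) (expR \o (fun s : R => - M * s)) (- M * expR (- M * s)).
  apply: is_derive_eq; by rewrite /GRing.scale /= mulr1 mulrC.
pose dN (s : R) : R := ((b s * (- 3 * g3 * c s * d s)) *+ 2 + (d s * (- 12 * a s * b s)) *+ 2
              - M * (b s * b s + d s * d s)) * expR (- M * s).
have Nle : N t <= N 0.
  apply: (@is_derive_nonincreasing _ N dN 0 T _ _ _ 0 t (lexx 0) t0 tT).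
  - move=> s /GT/(flow_cont F)[_ cb _ cd].
    apply: cvgM; first by apply: cvgD; apply: cvgM.
    by apply: differentiable_continuous; apply/derivable1_diffP; case: (dE s).
  - move=> s /andP[s1 s2]; have sOm : 0 < s < Om by rewrite s1 (lt_le_trans s2).
    have [|_ db _ dd] := flow_ode F sOm; first by apply: GT; rewrite !ltW.
    have dN' := is_deriveM (is_deriveD (is_deriveM db db) (is_deriveM dd dd)) (dE s).
    apply: (is_derive_eq dN'); rewrite /GRing.scale /= /dN !fctE; ring.
  - move=> s /andP[s1 s2]; rewrite /dN pmulr_lle0 ?expR_gt0//.
    have : h s <= M by apply: sM; rewrite in_itv /= !ltW.
    rewrite /h ler_norml => /andP[h1 h2].
    set X := 3 * g3 * c s + 12 * a s in h1 h2.
    (* A sum of squares whose coefficients [M + X] and [M - X] are nonnegative because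
       [|X| <= M]. *)
    have -> : (b s * (- 3 * g3 * c s * d s)) *+ 2 + (d s * (- 12 * a s * b s)) *+ 2
       - M * (b s * b s + d s * d s) =
       - ((M + X) * (b s + d s) ^+ 2 + (M - X) * (b s - d s) ^+ 2) / 2.
      by rewrite /X; field.
    rewrite mulNr oppr_le0 divr_ge0// addr_ge0// mulr_ge0 ?sqr_ge0//; lra.
have [_ _ b0 _ d0] := flow_start F.
have : N 0 = 0 by rewrite /N !fctE b0 d0; ring.
move=> N0; move: Nle; rewrite N0 /N !fctE pmulr_lle0 ?expR_gt0// => bd.
have b2 : 0 <= b t * b t by rewrite -expr2 sqr_ge0.
have d2 : 0 <= d t * d t by rewrite -expr2 sqr_ge0.
by split; apply/eqP; rewrite -sqrf_eq0 expr2; apply/eqP; lra.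
Qed.

(** Once the flow is known to be real, [b] vanishes and [c' = - 6 a^2]. *)
Lemma flow_c_nonincreasing (R : realType) (g3 Om : R) (G : set R)
    (a b c d x y : R -> R) (T : R) :
  real_axis_flow g3 Om G a b c d x y -> 0 <= T <= Om ->
  (forall t : R, 0 <= t <= T -> G t) ->
  forall s t : R, 0 <= s -> s <= t -> t <= T -> c t <= c s.
Proof.
move=> F TOm GT.
have re := flow_real F TOm GT; case/andP: TOm => T0 TOm.
apply: (@is_derive_nonincreasing _ c (fun t => - 6 * (a t ^+ 2 - b t ^+ 2))).
- by move=> t /GT/(flow_cont F)[].
- move=> t /andP[t0 tT]; have [| |//] := flow_ode F (t := t).
    by rewrite t0 (lt_le_trans tT).
  by apply: GT; rewrite !ltW.
- move=> t /andP[t0 tT]; have [|-> _] := re t; first by rewrite !ltW.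
  by rewrite expr0n subr0 mulNr oppr_le0 mulr_ge0// sqr_ge0.
Qed.

(** If [G] filled [[0, Om]], the monotone [c] would vanish at both ends, hence at [Om / 2], where
    [1 / wp'] is nonzero and real. So the complement of [G] is nonempty, and [S] is its infimum. *)
Lemma flow_first_zero (R : realType) (g3 Om : R) (G : set R)
    (a b c d x y : R -> R) :
  real_axis_flow g3 Om G a b c d x y ->
  exists S, [/\ 0 < S < Om, ~ G S,
    forall t : R, 0 <= t < S -> [/\ G t, b t = 0 & d t = 0] &
    forall t : R, 0 < t < S -> c t < 0].
Proof.
move=> F; have Om0 := flow_gt0 F.
have [G0 _ _ c0 _] := flow_start F; have [GOm cOm] := flow_end F.
pose A := [set t : R | 0 <= t <= Om /\ ~ G t].
have A0 : A !=set0.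
  apply: contrapT => /forallNP A0.
  have GT t : 0 <= t <= Om -> G t.
    by move=> tOm; apply: contrapT => Gt; apply: (A0 t).
  have OmOm : 0 <= Om <= Om by rewrite ltW /=.
  have cle := flow_c_nonincreasing F OmOm GT.
  have hOm : 0 < Om / 2 < Om by apply/andP; split; lra.
  have hOm' : 0 <= Om / 2 <= Om by apply/andP; split; lra.
  have [_ d2] := flow_real F OmOm GT hOm'.
  have c2 : c (Om / 2) = 0.
    apply/eqP; rewrite eq_le; apply/andP; split.
      by rewrite -c0; apply: cle; lra.
    by rewrite -cOm; apply: cle; lra.
  by have [] := flow_neq0 F hOm (GT _ hOm'); rewrite ?c2 ?d2 eqxx.
have lA : has_lbound A by exists 0 => t [/andP[]].
pose S := inf A.
have S0 : 0 <= S by apply: lb_le_inf => // t [/andP[]].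
have SOm : S <= Om.
  by case: A0 => t At; apply: (le_trans (ge_inf lA At)); case: At => /andP[].
(* [G] is open, so the infimum is attained: a neighbourhood of [S] inside [G] would contain a point
   of [A]. *)
have GS : ~ G S.
  move=> /(flow_open F)/nbhs_ballP[r /= r0 rG].
  have [t At tS] := inf_adherent r0 (conj A0 lA).
  have [_] := At; apply; apply: rG.
  rewrite -ball_normE /= distrC ger0_norm ?subr_ge0; last exact: ge_inf.
  by rewrite ltrBlDl.
have Slt0 : 0 < S by rewrite lt_def S0 andbT; apply/eqP => E; apply: GS; rewrite E.
have SltOm : S < Om.
  by rewrite lt_def SOm andbT; apply/eqP => E; apply: GS; rewrite -E.
have GltS t : 0 <= t < S -> G t.
  move=> /andP[t0 tS]; apply: contrapT => Gt.
  have /(ge_inf lA) : A t by split=> //; rewrite t0 ltW// (lt_le_trans tS).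
  by rewrite leNgt tS.
have sub t : t < S -> forall s : R, 0 <= s <= t -> G s.
  by move=> tS s /andP[s0 st]; apply: GltS; rewrite s0 (le_lt_trans st).
have tOm t : 0 <= t < S -> 0 <= t <= Om.
  by move=> /andP[-> tS] /=; rewrite ltW// (lt_trans tS).
exists S; split => //; first by rewrite Slt0.
  move=> t tS; have [t0 tS'] := andP tS.
  have [|-> ->] := flow_real F (tOm _ tS) (sub _ tS') (t := t).
    by rewrite t0 lexx.
  by split=> //; exact: GltS.
move=> t /andP[t0 tS]; have tS' : 0 <= t < S by rewrite ltW.
have ct : c t <= 0.
  by rewrite -c0; apply: (flow_c_nonincreasing F (tOm _ tS') (sub _ tS)) => //; exact: ltW.
(* [c] and [d] cannot both vanish inside the period, and [d] does, so [c <= 0] is strict. *)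
have [|_ dt] := flow_real F (tOm _ tS') (sub _ tS) (t := t).
  by rewrite ltW/=.
have [| | |] := flow_neq0 F (t := t).
- by rewrite t0 (lt_trans tS).
- exact: GltS.
- by rewrite lt_def eq_sym ct => ->.
- by rewrite dt eqxx.
Qed.

(** * Gamma and Beta integrals *)

Local Notation mu := (@lebesgue_measure _).

Lemma continuous_measurable_0y (R : realType) (f : R -> R) :
  (forall r : R, 0 < r -> {for r, continuous f}) ->
  measurable_fun (`]0, +oo[ : set R) f.
Proof.
move=> cf; apply: open_continuous_measurable_fun; first exact: interval_open.
by move=> r; rewrite inE /= in_itv /= andbT => /cf.
Qed.

(** Monotone convergence along compact intervals. The centre [c] is free so that scaling by [c]
    carries the exhaustion around [1] to the one around [c]. *)
Lemma integral_0y_exhaust (R : realType) (f : R -> R) (c : R) : 0 < c ->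
  measurable_fun (`]0, +oo[ : set R) f ->
  (forall r : R, 0 < r -> 0 <= f r) ->
  (\int[mu]_(x in `[(c / n.+1%:R)%R, (c * n.+1%:R)%R]) (f x)%:E @[n --> \oo]
    --> \int[mu]_(x in `]0%R, +oo[) (f x)%:E)%E.
Proof.
move=> c0 mf f0.
have sub n : `[c / n.+1%:R, c * n.+1%:R] `<=` (`]0, +oo[ : set R).
  move=> r /=; rewrite !in_itv /= andbT => /andP[+ _]; apply: lt_le_trans.
  by rewrite divr_gt0.
have -> : `]0, +oo[%classic = \bigcup_n `[c / n.+1%:R, c * n.+1%:R]%classic :> set R.
  apply/seteqP; split => [r|r [n _]]; last exact: sub.
  rewrite /= in_itv /= andbT => r0.
  (* The index plus one exceeds both [c / r] and [r / c], which places [r] in the interval. *)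
  exists (Num.truncn (c / r + r / c)) => //=; rewrite in_itv /=.
  have h : c / r + r / c < (Num.truncn (c / r + r / c)).+1%:R.
    by have /andP[] := truncn_itv (addr_ge0 (ltW (divr_gt0 c0 r0)) (ltW (divr_gt0 r0 c0))).
  set m := _.+1%:R in h *.
  have m0 : 0 < m by rewrite /m.
  have rc : 0 < r / c by rewrite divr_gt0.
  have cr : 0 < c / r by rewrite divr_gt0.
  apply/andP; split.
    rewrite ler_pdivrMr// mulrC -ler_pdivrMr//; lra.
  rewrite mulrC -ler_pdivrMr//; lra.
apply: ge0_nondecreasing_set_cvg_integral.
- apply/nondecreasing_seqP => n; rewrite subsetEset => r /=.
  rewrite !in_itv /= => /andP[r1 r2]; apply/andP; split.
    by apply: le_trans r1; rewrite ler_pM2l// lef_pV2 ?posrE// ler_nat.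
  by apply: (le_trans r2); rewrite ler_pM2l// ler_nat.
- by move=> n; exact: measurable_itv.
- move=> n; apply/measurable_EFinP; exact: (measurable_funS _ (sub n)).
- move=> n r /sub; rewrite /= in_itv /= andbT lee_fin; exact: f0.
Qed.

(** The fundamental theorem on [[1/n, n]], then monotone convergence on one side and the two limits
    of [F] on the other. *)
Lemma integral_0y_FTC (R : realType) (f F : R -> R) (l0 l1 : R) :
  (forall r : R, 0 < r -> {for r, continuous f}) ->
  (forall r : R, 0 < r -> 0 <= f r) ->
  (forall r : R, 0 < r -> is_derive r 1 F (f r)) ->
  F r @[r --> 0^'+] --> l0 -> F r @[r --> +oo] --> l1 ->
  (\int[mu]_(r in `]0%R, +oo[) (f r)%:E = (l1 - l0)%:E)%E.
Proof.
move=> cf f0 dF F0 F1.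
have E := integral_0y_exhaust ltr01 (continuous_measurable_0y cf) f0.
rewrite -(cvg_lim _ E)//.
apply/cvg_lim => //.
have cF r : 0 < r -> {for r, continuous F}.
  move=> r0; apply: differentiable_continuous; apply/derivable1_diffP.
  by have [] := dF r r0.
have Fn : (F (1 * n.+1%:R) - F (1 / n.+1%:R))%:E @[n --> \oo] --> (l1 - l0)%:E.
  apply: cvg_EFin; first exact: nearW.
  have Fy : F (1 * n.+1%:R) @[n --> \oo] --> l1.
    have h : (1 * n.+1%:R : R) @[n --> \oo] --> +oo.
      apply/cvgryPge => A; near=> n; rewrite mul1r.
      rewrite (le_trans (_ : A <= n%:R)) ?ler_nat//.
      by near: n; exact: nbhs_infty_ger.
    exact: (cvg_comp _ _ h).
  have F0' : F (1 / n.+1%:R) @[n --> \oo] --> l0.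
    move/cvg_at_rightP : F0; apply; split; first by move=> n; rewrite divr_gt0.
    have -> : (fun n : nat => 1 / n.+1%:R : R) = harmonic.
      by apply/funext => n; rewrite div1r.
    exact: cvg_harmonic.
  exact: cvgB.
apply: cvg_trans Fn; apply: near_eq_cvg; near=> n.
symmetry.
have n1 : 1 < n.+1%:R :> R by rewrite ltr1n ltnS; near: n; exact: nbhs_infty_gt.
have lt1 : 1 / n.+1%:R < 1 * n.+1%:R :> R.
  by rewrite !mul1r (lt_trans _ n1)// invf_lt1// (lt_trans _ n1).
have pos r : 1 / n.+1%:R <= r -> 0 < r.
  by apply: lt_le_trans; rewrite divr_gt0.
rewrite (@continuous_FTC2 _ f F)//.
- apply: continuous_in_subspaceT => r; rewrite inE /= in_itv /= => /andP[/pos + _].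
  exact: cf.
- split.
  + by move=> r; rewrite in_itv /= => /andP[/ltW/pos/dF[]].
  + by apply: cvg_at_right_filter; apply: cF; apply: pos.
  + by apply: cvg_at_left_filter; apply: cF; apply: pos; exact: ltW.
- move=> r; rewrite in_itv /= => /andP[/ltW/pos/dF[_ <-] _].
  by rewrite derive1E.
Unshelve. all: by end_near. Qed.

Lemma integral_0y_scale (R : realType) (f : R -> R) (c : R) : 0 < c ->
  (forall r : R, 0 < r -> {for r, continuous f}) ->
  (forall r : R, 0 < r -> 0 <= f r) ->
  (\int[mu]_(r in `]0%R, +oo[) (f (c * r) * c)%:E =
   \int[mu]_(r in `]0%R, +oo[) (f r)%:E)%E.
Proof.
move=> c0 cf f0.
have E1 := integral_0y_exhaust c0 (continuous_measurable_0y cf) f0.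
have cfc r : 0 < r -> {for r, continuous (fun r => f (c * r) * c)}.
  move=> r0; apply: cvgMl; apply: continuous_comp; first exact: mulrl_continuous.
  by apply: cf; rewrite mulr_gt0.
have fc0 r : 0 < r -> 0 <= f (c * r) * c.
  by move=> r0; rewrite mulr_ge0 ?f0 ?mulr_gt0// ltW.
have E2 := integral_0y_exhaust ltr01 (continuous_measurable_0y cfc) fc0.
rewrite -(cvg_lim _ E1)// -(cvg_lim _ E2)//.
(* Multiplication by [c] maps [[1/n, n]] onto [[c/n, c n]], so the two exhaustions match term by
   term. *)
have -> // : (fun n => \int[mu]_(x in `[(1 / n.+1%:R)%R, (1 * n.+1%:R)%R])
    (f (c * x) * c)%:E)%E =
  (fun n => \int[mu]_(x in `[(c / n.+1%:R)%R, (c * n.+1%:R)%R]) (f x)%:E)%E.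
apply/funext => n.
have dc (r : R) : is_derive r (1 : R) (fun r : R => c * r) c.
  by apply: is_derive_eq; rewrite /GRing.scale /= mulr1.
have d1 : derive1 (fun r : R => c * r) = cst c.
  by apply/funext => r; rewrite derive1E; case: (dc r).
have cc : continuous (fun r : R => c * r) by exact: mulrl_continuous.
have := @integration_by_substitution_increasing _ (fun r => c * r) f
  (1 / n.+1%:R) (1 * n.+1%:R).
rewrite d1 /=.
rewrite mul1r mulrA mulr1 mul1r => ->; first by [].
- by rewrite (@le_trans _ _ 1)// ?invf_le1// ?ler1n.
- by move=> u v _ _ uv; rewrite ltr_pM2l.
- by move=> r _; exact: cst_continuous.
- exact: is_cvg_cst.
- exact: is_cvg_cst.
- split.
  + by move=> r _; case: (dc r).
  + by apply: cvg_at_right_filter; exact: cc.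
  + by apply: cvg_at_left_filter; exact: cc.
- apply: continuous_in_subspaceT => r; rewrite inE /= in_itv /= => /andP[r0 _].
  by apply: cf; apply: lt_le_trans r0; rewrite divr_gt0.
Qed.

(** Extended-real values let Tonelli's theorem apply before finiteness is known. *)
Definition Gamma_e (R : realType) (x : R) : \bar R :=
  (\int[mu]_(t in `]0%R, +oo[) (t `^ (x - 1) * expR (- t))%:E)%E.

(** For positive [x] and [y], Euler's integral of [t^(x-1) (1-t)^(y-1)] over []0, 1[] after the
    substitution [t = 1 / (1 + r)]. *)
Definition Beta_e (R : realType) (x y : R) : \bar R :=
  (\int[mu]_(r in `]0%R, +oo[) (r `^ (y - 1) * (1 + r) `^ (- (x + y)))%:E)%E.

Lemma continuous_powR (R : realType) (p r : R) : 0 < r ->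
  {for r, continuous (fun s : R => s `^ p)}.
Proof.
move=> r0; apply: differentiable_continuous; apply/derivable1_diffP.
by apply: derivable_powR; rewrite in_itv /= r0.
Qed.

Lemma Gamma_e_continuous (R : realType) (x r : R) : 0 < r ->
  {for r, continuous (fun t : R => t `^ (x - 1) * expR (- t))}.
Proof.
move=> r0; apply: cvgM; first exact: continuous_powR.
apply: continuous_comp; first exact: opp_continuous.
exact: continuous_expR.
Qed.

Lemma Gamma_e_integrand_ge0 (R : realType) (x t : R) :
  0 <= t `^ (x - 1) * expR (- t).
Proof. by rewrite mulr_ge0 ?powR_ge0 ?expR_ge0. Qed.

(** With [c = 1 + r] this is the inner integral on the Beta side of Tonelli's theorem. *)
Lemma Gamma_e_scale (R : realType) (x c : R) : 0 < c ->
  (\int[mu]_(t in `]0%R, +oo[) (t `^ (x - 1) * expR (- (c * t)))%:E =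
   (c `^ (- x))%:E * Gamma_e x)%E.
Proof.
move=> c0.
rewrite /Gamma_e -(integral_0y_scale c0 (@Gamma_e_continuous _ x)); last first.
  by move=> r _; exact: Gamma_e_integrand_ge0.
rewrite -ge0_integralZl//; last 3 first.
- apply/measurable_EFinP; apply: continuous_measurable_0y => r r0.
  apply: cvgMl; apply: (@continuous_comp _ _ _ (fun r : R => c * r)
     (fun r => r `^ (x - 1) * expR (- r))); first exact: mulrl_continuous.
  by apply: Gamma_e_continuous; rewrite mulr_gt0.
- by move=> r _; rewrite lee_fin mulr_ge0 ?Gamma_e_integrand_ge0// ltW.
- by rewrite lee_fin powR_ge0.
apply: eq_integral => t; rewrite inE /= in_itv /= andbT => t0.
rewrite -EFinM; congr (_%:E).
rewrite powRM ?ltW//.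
have E : c `^ (- x) * (c `^ (x - 1) * c) = 1.
  rewrite -[X in _ * (_ * X)]powRr1 ?ltW// -!powRD ?(gt_eqF c0) ?implybT//.
  by rewrite (_ : _ + _ = 0) ?powRr0//; ring.
by rewrite -[LHS]mul1r -[X in X * _ = _]E; ring.
Qed.

Lemma Gamma_e_ge0 (R : realType) (x : R) : (0 <= Gamma_e x)%E.
Proof. by apply: integral_ge0 => t _; rewrite lee_fin Gamma_e_integrand_ge0. Qed.

Lemma Gamma_e_measurable (R : realType) (x : R) :
  measurable_fun (`]0, +oo[ : set R) (fun t : R => (t `^ (x - 1) * expR (- t))%:E).
Proof.
by apply/measurable_EFinP; apply: continuous_measurable_0y; exact: Gamma_e_continuous.
Qed.

Lemma Beta_e_measurable (R : realType) (x y : R) :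
  measurable_fun (`]0, +oo[ : set R)
    (fun r : R => (r `^ (y - 1) * (1 + r) `^ (- (x + y)))%:E).
Proof.
apply/measurable_EFinP; apply: continuous_measurable_0y => r r0.
apply: cvgM; first exact: continuous_powR.
apply: (@continuous_comp _ _ _ (fun s : R => 1 + s) (fun s : R => s `^ (- (x + y)))).
  by apply: cvgD; [exact: cvg_cst | exact: cvg_id].
by apply: continuous_powR; rewrite ltr_wpDl.
Qed.

(* Tonelli for [t^(x+y-1) exp(-t(1+r)) r^(y-1)] on the quadrant, where
   [s = t r] turns the inner integral over [r] into that of [Gamma y]. *)
Lemma Gamma_e_Beta_e (R : realType) (x y : R) :
  (Gamma_e x * Gamma_e y = Gamma_e (x + y) * Beta_e x y)%E.
Proof.
pose D : set R := `]0, +oo[%classic.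
have mD : measurable D by exact: measurable_itv.
(* The indicators extend the integrand by zero, so that Tonelli applies on the whole plane. *)
pose h (p : R * R) : R := (\1_D p.1 * (p.1 `^ (x + y - 1))) *
   (\1_D p.2 * (p.2 `^ (y - 1))) * expR (- (p.1 * (1 + p.2))).
have mp (q : R) : measurable_fun setT (fun t : R => \1_D t * t `^ q).
  by apply: measurable_funM; [exact: measurable_indic | exact: measurable_powR].
have mh : measurable_fun setT (EFin \o h).
  apply/measurable_EFinP; apply: measurable_funM; first apply: measurable_funM.
  - exact: (measurableT_comp (mp _) measurable_fst).
  - exact: (measurableT_comp (mp _) measurable_snd).
  - apply: (measurableT_comp (@measurable_expR R)).
    apply: (measurableT_comp (@oppr_measurable R setT)).
    apply: measurable_funM; first exact: measurable_fst.
    by apply: measurable_funD => //; exact: measurable_snd.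
have h0 p : (0 <= (EFin \o h) p)%E.
  by rewrite /= lee_fin !mulr_ge0 ?powR_ge0 ?expR_ge0.
have FT := fubini_tonelli (m1 := mu) (m2 := mu) (EFin \o h) mh h0.
have L : (\int[mu]_t \int[mu]_r (EFin \o h) (t, r) = Gamma_e x * Gamma_e y)%E.
  have E := ge0_integralZl mu mD (@Gamma_e_measurable R x)
    (fun t _ => Gamma_e_integrand_ge0 x t) (Gamma_e_ge0 y).
  rewrite muleC -[RHS]E {E}.
  rewrite [RHS]integral_mkcond; apply: eq_integral => t _.
  rewrite patchE; case: ifPn => tD; last first.
    apply: integral0_eq => r _.
    by rewrite /h /= indicE (negbTE tD) !mul0r.
  have t0 : 0 < t by move: tD; rewrite inE /D /= in_itv /= andbT.
  pose g (r : R) : R := (t * r) `^ (y - 1) * expR (- (t * r)) * t.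
  have mg : measurable_fun D (EFin \o g).
    apply/measurable_EFinP; apply: continuous_measurable_0y => r r0.
    apply: cvgMl; apply: (@continuous_comp _ _ _ (fun r : R => t * r)
     (fun r => r `^ (y - 1) * expR (- r))); first exact: mulrl_continuous.
    by apply: Gamma_e_continuous; rewrite mulr_gt0.
  have g0 r : D r -> (0 <= (EFin \o g) r)%E.
    move=> _; rewrite /= lee_fin /g; apply: mulr_ge0; last exact: ltW.
    exact: Gamma_e_integrand_ge0.
  have GE : Gamma_e y = (\int[mu]_(r in D) (EFin \o g) r)%E.
    exact: (esym (integral_0y_scale t0 (@Gamma_e_continuous _ y)
      (fun r _ => Gamma_e_integrand_ge0 y r))).
  have k0 : (0 <= (t `^ (x - 1) * expR (- t))%:E)%E.
    by rewrite lee_fin Gamma_e_integrand_ge0.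
  rewrite GE muleC -[RHS](ge0_integralZl mu mD mg g0 k0).
  rewrite [RHS]integral_mkcond; apply: eq_integral => r _.
  rewrite patchE; case: ifPn => rD; last first.
    by rewrite /h /= [\1_D r]indicE (negbTE rD) !(mul0r, mulr0).
  have r0 : 0 < r by move: rD; rewrite inE /D /= in_itv /= andbT.
  rewrite /= -EFinM; congr (_%:E); rewrite /h /g /= !indicE tD rD.
  (* The last factor [t] is the Jacobian of [s = t r]. *)
  have tE : t `^ (x + y - 1) = t `^ (x - 1) * t `^ (y - 1) * t.
    have t1 p q : t `^ (p + q) = t `^ p * t `^ q.
      by apply: powRD; rewrite (gt_eqF t0) implybT.
    by rewrite -{4}(powRr1 (ltW t0)) -!t1; congr (_ `^ _); ring.
  rewrite tE (powRM _ (ltW t0) (ltW r0)) mulrDr mulr1 opprD expRD.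
  by rewrite !mul1r; ring.
have Rt : (\int[mu]_r \int[mu]_t (EFin \o h) (t, r) = Gamma_e (x + y) * Beta_e x y)%E.
  have B0 (r : R) : D r -> (0 <= (r `^ (y - 1) * (1 + r) `^ (- (x + y)))%:E)%E.
    by move=> _; rewrite lee_fin mulr_ge0 ?powR_ge0.
  have E := ge0_integralZl mu mD (@Beta_e_measurable R x y) B0 (Gamma_e_ge0 (x + y)).
  rewrite -[RHS]E {E}.
  rewrite [RHS]integral_mkcond; apply: eq_integral => r _.
  rewrite patchE; case: ifPn => rD; last first.
    apply: integral0_eq => t _.
    by rewrite /h /= [\1_D r]indicE (negbTE rD) !(mul0r, mulr0).
  have r0 : 0 < r by move: rD; rewrite inE /D /= in_itv /= andbT.
  have r10 : 0 < 1 + r by rewrite ltr_wpDl.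
  rewrite EFinM muleC -muleA -(Gamma_e_scale (x + y) r10).
  pose g (t : R) : R := t `^ (x + y - 1) * expR (- ((1 + r) * t)).
  have mg : measurable_fun D (EFin \o g).
    apply/measurable_EFinP; apply: continuous_measurable_0y => t t0.
    apply: cvgM; first exact: continuous_powR.
    apply: (@continuous_comp _ _ _ (fun t : R => - ((1 + r) * t)) expR).
      by apply: cvgN; exact: mulrl_continuous.
    exact: continuous_expR.
  have g0 t : D t -> (0 <= (EFin \o g) t)%E.
    by move=> _; rewrite /= lee_fin /g mulr_ge0 ?powR_ge0 ?expR_ge0.
  have k0 : (0 <= (r `^ (y - 1))%:E)%E by rewrite lee_fin powR_ge0.
  rewrite -[RHS](ge0_integralZl mu mD mg g0 k0).
  rewrite [RHS]integral_mkcond; apply: eq_integral => t _.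
  rewrite patchE; case: ifPn => tD; last first.
    by rewrite /h /= indicE (negbTE tD) !mul0r.
  have t0 : 0 < t by move: tD; rewrite inE /D /= in_itv /= andbT.
  rewrite /= -EFinM; congr (_%:E); rewrite /h /g /= !indicE tD rD.
  by rewrite !mul1r [t * _]mulrC; ring.
by rewrite -L -Rt; exact: FT.
Qed.

(** * Special values, functional equation, finiteness and positivity *)

Lemma continuous_powR_1D (R : realType) (p r : R) : 0 <= r ->
  {for r, continuous (fun s : R => (1 + s) `^ p)}.
Proof.
move=> r0; apply: (@continuous_comp _ _ _ (fun s : R => 1 + s) (fun s : R => s `^ p)).
  by apply: cvgD; [exact: cvg_cst | exact: cvg_id].
by apply: continuous_powR; rewrite ltr_wpDr.
Qed.

Lemma powR_cvgy (R : realType) (p : R) : 0 < p -> (s : R) `^ p @[s --> +oo] --> +oo.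
Proof.
move=> p0; apply/cvgryPge => A; near=> s.
have AM : A <= Num.max A 1 by rewrite le_max lexx.
have M0 : 0 <= Num.max A 1 by rewrite le_max ler01 orbT.
apply: (le_trans AM); rewrite -(powRr1 M0) -(mulVf (lt0r_neq0 p0)) powRrM.
apply: ge0_ler_powR; rewrite ?nnegrE ?powR_ge0 ?ltW//.
Unshelve. all: by end_near. Qed.

Lemma Beta_e_1 (R : realType) (x : R) : 0 < x -> Beta_e x 1 = (x^-1)%:E.
Proof.
move=> x0.
pose F (r : R) : R := - x^-1 * (1 + r) `^ (- x).
have d1 (r : R) : is_derive r (1 : R) (fun s : R => 1 + s) 1.
  by have := is_deriveD (is_derive_cst (1 : R) r (1 : R)) (is_derive_id r 1); rewrite add0r.
have <- : (0 - (- x^-1))%:E = (x^-1)%:E by rewrite sub0r opprK.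
pose f (r : R) : R := r `^ (1 - 1) * (1 + r) `^ (- (x + 1)).
have cf (r : R) : 0 < r -> {for r, continuous f}.
  move=> r0; apply: cvgM; first exact: continuous_powR.
  by apply: continuous_powR_1D; exact: ltW.
have f0 (r : R) : 0 < r -> 0 <= f r.
  by move=> r0; rewrite mulr_ge0 ?powR_ge0.
have dF (r : R) : 0 < r -> is_derive r 1 F (f r).
  move=> r0; have r10 : 0 < 1 + r by rewrite ltr_wpDl.
  have dp := is_derive1_comp (is_derive1_powR (- x) r10) (d1 r).
  have dF := is_deriveM (is_derive_cst (- x^-1) r 1) dp.
  apply: (is_derive_eq dF); rewrite /GRing.scale /f /= subrr powRr0 opprD.
  by rewrite mulr0 addr0; field; rewrite gt_eqF.
have Fl0 : F r @[r --> 0^'+] --> - x^-1.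
  have <- : F 0 = - x^-1 by rewrite /F addr0 powR1 mulr1.
  by apply: cvg_at_right_filter; apply: cvgMr; exact: continuous_powR_1D.
have Fl1 : F r @[r --> +oo] --> 0.
  rewrite /F -[X in _ --> X](mulr0 (- x^-1)); apply: cvgMr.
  under eq_fun do rewrite powRN.
  apply/gtr0_cvgV0; first by near=> r; rewrite powR_gt0// ltr_wpDr.
  exact: (cvg_comp _ _ (cvg_addrl 1) (powR_cvgy x0)).
exact: (integral_0y_FTC cf f0 dF Fl0 Fl1).
Unshelve. all: by end_near. Qed.

(** With [r = s^2] the integrand becomes [2 / (1 + s^2)], whence the arctangent. This yields
    [Gamma(1/2)^2 = pi]. *)
Lemma Beta_e_half (R : realType) : Beta_e (2^-1 : R) 2^-1 = pi%:E.
Proof.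
pose F (r : R) : R := 2 * atan (r `^ 2^-1).
rewrite /Beta_e -[in RHS](subr0 pi).
pose f (r : R) : R := r `^ (2^-1 - 1) * (1 + r) `^ (- (2^-1 + 2^-1)).
have cf (r : R) : 0 < r -> {for r, continuous f}.
  move=> r0; apply: cvgM; first exact: continuous_powR.
  by apply: continuous_powR_1D; exact: ltW.
have f0 (r : R) : 0 < r -> 0 <= f r.
  by move=> r0; rewrite mulr_ge0 ?powR_ge0.
have dF (r : R) : 0 < r -> is_derive r 1 F (f r).
  move=> r0; have r10 : 0 < 1 + r by rewrite ltr_wpDl.
  have dp := @is_derive1_comp _ atan (fun s : R => s `^ 2^-1) r _ _
    (is_derive1_atan _) (is_derive1_powR 2^-1 r0).
  have dF := is_deriveM (is_derive_cst (2 : R) r 1) dp.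
  apply: (is_derive_eq dF); rewrite /GRing.scale /f /= mulr0 addr0.
  have -> : (r `^ 2^-1) ^+ 2 = r by rewrite powR12_sqrt ?ltW// sqr_sqrtr ?ltW.
  have -> : - (2^-1 + 2^-1) = -1 :> R by field.
  by rewrite powR_inv1 ?ltW//; field; rewrite gt_eqF.
have Fl0 : F r @[r --> 0^'+] --> 0.
  rewrite /F -[X in _ --> X](mulr0 2); apply: cvgMr.
  have half0 : 0 < 2^-1 :> R by rewrite invr_gt0.
  by have := cvg_comp _ _ (powR_cvg0 half0) (@continuous_atan _ 0); rewrite atan0.
have Fl1 : F r @[r --> +oo] --> pi.
  rewrite /F; have -> : pi = 2 * (pi / 2) :> R by field.
  have half0 : 0 < 2^-1 :> R by rewrite invr_gt0.
  by apply: cvgMr; exact: (cvg_comp _ _ (powR_cvgy half0) (@cvgy_atan R)).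
exact: (integral_0y_FTC cf f0 dF Fl0 Fl1).
Qed.

Lemma Gamma_e_1 (R : realType) : Gamma_e (1 : R) = 1%E.
Proof.
have <- : (0 - (- 1))%:E = 1%E :> \bar R by rewrite sub0r opprK.
apply: (@integral_0y_FTC _ _ (fun r : R => - expR (- r)) (- 1) 0).
- exact: Gamma_e_continuous.
- by move=> r _; exact: Gamma_e_integrand_ge0.
- move=> r _.
  have dN : is_derive r (1 : R) (fun s : R => - s) (- 1) by exact: is_deriveNid.
  have dF := is_deriveN (is_derive1_comp (is_derive_expR (- r)) dN).
  by apply: (is_derive_eq dF); rewrite subrr powRr0 mulrN1 opprK mul1r.
- have <- : - expR (- 0) = - 1 :> R by rewrite oppr0 expR0.
  apply: cvg_at_right_filter; apply: cvgN.
  have c : {for 0, continuous (fun s : R => expR (- s))}.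
    by apply: continuous_comp; [exact: opp_continuous | exact: continuous_expR].
  exact: c.
- rewrite -[X in _ --> X]oppr0; apply: cvgN; exact: cvgr_expR.
Qed.

(** The Gamma-Beta identity at [y = 1], in place of an integration by parts. *)
Lemma Gamma_e_succ (R : realType) (x : R) : 0 < x ->
  (Gamma_e (x + 1) = x%:E * Gamma_e x)%E.
Proof.
move=> x0; have := Gamma_e_Beta_e x 1.
rewrite Beta_e_1// Gamma_e_1 mule1 => ->.
by rewrite muleCA -EFinM divff ?mule1// gt_eqF.
Qed.

(** On the half-line [t^x <= 1 + t], so [Gamma(x + 1) <= Gamma(1) + Gamma(2)]; the functional
    equation carries finiteness down to [x]. *)
Lemma Gamma_e_fin (R : realType) (x : R) : 0 < x -> x <= 1 ->
  Gamma_e x \is a fin_num.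
Proof.
move=> x0 x1.
have G2 : Gamma_e (2 : R) = 1%E.
  by rewrite (_ : 2 = 1 + 1) ?Gamma_e_succ ?Gamma_e_1 ?mule1.
have mD : measurable (`]0, +oo[ : set R) by exact: measurable_itv.
have xle : (Gamma_e (x + 1) <= Gamma_e 1 + Gamma_e 2)%E.
  rewrite /Gamma_e -ge0_integralD//; last 4 first.
  - by move=> t _; rewrite lee_fin Gamma_e_integrand_ge0.
  - exact: Gamma_e_measurable.
  - by move=> t _; rewrite lee_fin Gamma_e_integrand_ge0.
  - exact: Gamma_e_measurable.
  apply: ge0_le_integral => //.
  - by move=> t _; rewrite lee_fin Gamma_e_integrand_ge0.
  - exact: Gamma_e_measurable.
  - by apply: emeasurable_funD; exact: Gamma_e_measurable.
  move=> t; rewrite /= in_itv /= andbT => t0.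
  rewrite -EFinD lee_fin -mulrDl ler_pM2r ?expR_gt0//.
  have -> : x + 1 - 1 = x by ring.
  have -> : 1 - 1 = 0 :> R by ring.
  have -> : 2 - 1 = 1 :> R by ring.
  rewrite powRr0 (powRr1 (ltW t0)).
  have [t1|t1] := leP 1 t.
    by rewrite (le_trans (ler1_powR t1 x1))// lerDr.
  have tx : t `^ x <= t `^ 0 by apply: ger_powR; rewrite ?t0 ?ltW.
  by rewrite (le_trans tx)// powRr0 lerDl ltW.
have : (Gamma_e (x + 1) < +oo)%E by rewrite (le_lt_trans xle)// Gamma_e_1 G2 -EFinD ltry.
rewrite Gamma_e_succ// => h.
rewrite ge0_fin_numE ?Gamma_e_ge0// ltey.
by apply: contraTN h => /eqP ->; rewrite gt0_muley ?lte_fin.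
Qed.

(** On []0, 1[] the integrand is at least [exp(-1)], as [t^(x-1) >= 1] there. *)
Lemma Gamma_e_gt0 (R : realType) (x : R) : x <= 1 -> (0 < Gamma_e x)%E.
Proof.
move=> x1.
have mI : measurable (`]0, 1[ : set R) by exact: measurable_itv.
have sub : `]0%R, 1%R[ `<=` (`]0, +oo[%classic : set R).
  by move=> t /=; rewrite !in_itv /= andbT => /andP[].
apply: (@lt_le_trans _ _ (\int[mu]_(t in `]0%R, 1%R[) (expR (- 1))%:E)%E).
  rewrite integral_cst//= lebesgue_measure_itv /= lte_fin ltr01 oppr0 adde0 mule1.
  by rewrite lte_fin expR_gt0.
apply: (@le_trans _ _ (\int[mu]_(t in `]0%R, 1%R[) (t `^ (x - 1) * expR (- t))%:E)%E).
  apply: ge0_le_integral => //.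
  - exact: (measurable_funS _ sub (@Gamma_e_measurable _ x)).
  - move=> t; rewrite /= in_itv /= => /andP[t0 t1].
    have tx : t `^ 0 <= t `^ (x - 1).
      by apply: ger_powR; rewrite ?subr_le0// t0 ltW.
    rewrite powRr0 in tx; rewrite lee_fin -[leLHS]mul1r.
    by apply: ler_pM => //; rewrite ler_expR lerN2 ltW.
apply: ge0_subset_integral => //.
- exact: Gamma_e_measurable.
- by move=> t _; rewrite lee_fin Gamma_e_integrand_ge0.
Qed.

(** * The period as a Beta integral *)

(** All exponents in play are multiples of [1/6], so the substitution [a = u^6] turns the identities
    below into rational ones in [u]. *)
Lemma powR_sixth (R : realType) (a : R) : 0 < a ->
  let u := a `^ 6^-1 in
  [/\ 0 < u, a = u ^+ 6, a `^ (- 3^-1) = u ^- 2, a `^ (- 3^-1 - 1) = u ^- 8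
    & a `^ (- (3^-1 + 2^-1)) = u ^- 5].
Proof.
move=> a0 u; have u0 : 0 < u by rewrite powR_gt0.
have E (n : nat) : a `^ (- (6^-1 * n%:R)) = u ^- n.
  by rewrite powRN powRrM powR_mulrn// ltW.
split=> //.
- by rewrite -powR_mulrn ?ltW// -powRrM mulVf ?powRr1 ?ltW.
- by rewrite -E; congr (_ `^ _); field.
- by rewrite -E; congr (_ `^ _); field.
- by rewrite -E; congr (_ `^ _); field.
Qed.

(* With [c = 1 / (1 + r)] and [X = - 3 c^(1/3)], this is [2/3] times the
   [x]-coordinate [(X^3 + 108) / (9 X^2)] of the 3-isogeny from [Y^2 = X^3 + 27]
   to [y^2 = x^3 - 1], where [2/3] is the real root of [4 x^3 = 32/27]. *)
Definition isog (R : realType) (r : R) : R := 2 / 9 * (3 + 4 * r) * (1 + r) `^ (- 3^-1).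

Lemma isog_derive (R : realType) (r : R) : 0 < r ->
  is_derive r 1 (@isog R) (2 / 27 * (9 + 8 * r) * (1 + r) `^ (- 3^-1 - 1)).
Proof.
move=> r0; have r10 : 0 < 1 + r by rewrite ltr_wpDl.
have d1 : is_derive r (1 : R) (fun s : R => 1 + s) 1.
  by have := is_deriveD (is_derive_cst (1 : R) r (1 : R)) (is_derive_id r 1); rewrite add0r.
have dp := is_derive1_comp (is_derive1_powR (- 3^-1) r10) d1.
have dl : is_derive r (1 : R) (fun s : R => 2 / 9 * (3 + 4 * s)) (8 / 9).
  by apply: is_derive_eq; rewrite /GRing.scale /=; field.
apply: (is_derive_eq (is_deriveM dl dp)); rewrite /GRing.scale /=.
have [u0 E -> -> _] := powR_sixth r10.
set u := _ `^ 6^-1 in u0 E *.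
have -> : r = u ^+ 6 - 1 by rewrite -E; ring.
by field; rewrite gt_eqF.
Qed.

(** The base on the right is, up to sign, the second coordinate on the curve. It shares the factor
    [9 + 8 r] with the derivative of [isog], and their quotient is the integrand of
    [Beta_e 3^-1 2^-1] divided by [2 sqrt 2]. *)
Lemma isog_sqr (R : realType) (r : R) : 0 < r ->
  4 * isog r ^+ 3 - 32 / 27 =
  ((9 + 8 * r) * (4 * Num.sqrt 2 / 27) * (r `^ 2^-1 * ((1 + r) `^ 6^-1) ^- 3)) ^+ 2.
Proof.
move=> r0; have r10 : 0 < 1 + r by rewrite ltr_wpDl.
rewrite /isog; have [u0 E -> _ _] := powR_sixth r10.
set u := _ `^ 6^-1 in u0 E *.
have s2 : Num.sqrt 2 ^+ 2 = 2 :> R by rewrite sqr_sqrtr.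
have A2 : (r `^ 2^-1) ^+ 2 = r by rewrite powR12_sqrt ?ltW// sqr_sqrtr ?ltW.
set A := r `^ _ in A2 *; set s := Num.sqrt 2 in s2 *.
transitivity ((9 + 8 * r) ^+ 2 * (16 * s ^+ 2 / 27 ^+ 2) * (A ^+ 2 * u ^- 6)); last first.
  by field; rewrite gt_eqF.
rewrite s2 A2; have -> : r = u ^+ 6 - 1 by rewrite -E; ring.
by field; rewrite gt_eqF.
Qed.

(** By [isog_sqr], [4 isog^3 - 32/27] is a nonzero square, so [isog^3 > (2/3)^3]. *)
Lemma isog_gt (R : realType) (r : R) : 0 < r -> 2 / 3 < isog r.
Proof.
move=> r0; have r10 : 0 < 1 + r by rewrite ltr_wpDl.
have [u0 E _ _ _] := powR_sixth r10.
have i0 : 0 <= isog r.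
  by rewrite /isog mulr_ge0 ?powR_ge0// mulr_ge0// addr_ge0// mulr_ge0// ltW.
have : 0 < 4 * isog r ^+ 3 - 32 / 27.
  rewrite isog_sqr// exprn_gt0// mulr_gt0 ?mulr_gt0 ?divr_gt0 ?powR_gt0//
    ?sqrtr_gt0 ?invr_gt0 ?exprn_gt0//; lra.
move=> h; rewrite -(@ltr_pXn2r _ 3)// ?nnegrE ?divr_ge0//.
rewrite (_ : (2 / 3) ^+ 3 = 8 / 27); last by field.
by lra.
Qed.

Lemma isog_cvg0 (R : realType) : @isog R r @[r --> 0^'+] --> (2 / 3 : R).
Proof.
have <- : isog 0 = 2 / 3 :> R by rewrite /isog mulr0 !addr0 powR1 mulr1; field.
apply: cvg_at_right_filter; apply: cvgM; last exact: continuous_powR_1D.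
by apply: cvgMr; apply: cvgD; [exact: cvg_cst | exact: mulrl_continuous].
Qed.

Lemma isog_cvgy (R : realType) : @isog R r @[r --> +oo] --> +oo.
Proof.
have p0 : 0 < 2 / 3 :> R by rewrite divr_gt0.
have h := cvg_comp _ _ (cvg_addrl (1 : R)) (powR_cvgy p0).
apply/cvgryPge => A; near=> r.
have r0 : 0 <= r by near: r; exact: nbhs_pinfty_ge.
have r10 : 0 < 1 + r by rewrite ltr_wpDr.
(* [isog r >= 2/3 (1 + r)^(2/3)], because [3 + 4 r >= 3 (1 + r)]. *)
have : 3 / 2 * A <= (1 + r) `^ (2 / 3).
  by near: r; move/cvgryPge : h; apply.
have -> : (1 + r) `^ (2 / 3) = (1 + r) * (1 + r) `^ (- 3^-1).
  rewrite -{2}(powRr1 (ltW r10)) -powRD ?(gt_eqF r10) ?implybT//.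
  by congr (_ `^ _); field.
have := powR_ge0 (1 + r) (- 3^-1); rewrite /isog; set w := _ `^ _ => w0 h'.
have : 0 <= r * w by rewrite mulr_ge0.
lra.
Unshelve. all: by end_near. Qed.

(** [p] is a decreasing bijection from []0, S[] onto []e, +oo[], and [T] is its inverse, the time at
    which a level is reached. The last two clauses serve to compute the limits of [T] at the
    ends. *)
Lemma descent_time (R : realType) (S e : R) (p q : R -> R) :
  0 < S ->
  (forall t : R, 0 < t < S -> is_derive t 1 p (q t)) ->
  (forall t : R, 0 < t < S -> q t < 0) ->
  p t @[t --> S^'-] --> e -> p t @[t --> 0^'+] --> +oo ->
  exists T : R -> R,
  [/\ forall t, 0 < t < S -> e < p t,
      forall y, e < y -> 0 < T y < S /\ p (T y) = y,
      forall y, e < y -> is_derive y 1 T (q (T y))^-1 &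
      (forall t y, 0 < t < S -> e < y -> y < p t -> t < T y) /\
      (forall t y, 0 < t < S -> p t < y -> T y < t)].
Proof.
move=> S0 dp q0 pS p0.
have cp t : 0 < t < S -> {for t, continuous p}.
  move=> tS; apply: differentiable_continuous; apply/derivable1_diffP.
  by case: (dp t tS).
have decr s t : 0 < s -> s < t -> t < S -> p t < p s.
  move=> s0 st tS.
  apply: (@ltr0_derive1_lt_oo _ p 0 S) => //.
  - by move=> x; rewrite in_itv /= => /dp[].
  - by move=> x; rewrite in_itv /= => xS; rewrite derive1E; case: (dp x xS) => _ ->; exact: q0.
  - by move=> x; rewrite inE /= in_itv /=; exact: cp.
  - by rewrite in_itv /= (lt_trans s0 st).
  - by rewrite in_itv /= s0 (lt_trans st tS).
have pge t : 0 < t < S -> e < p t.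
  move=> /andP[t0 tS].
  (* The limit alone gives [e <= p]; the midpoint supplies the strict inequality. *)
  pose t' := (t + S) / 2.
  have tt' : t < t' by rewrite /t'; lra.
  have t'S : t' < S by rewrite /t'; lra.
  apply: (@le_lt_trans _ _ (p t')); last exact: decr.
  apply: (cvgr_to_le pS).
  near=> s.
  apply/ltW/decr; [exact: lt_trans tt' | by near: s; exact: nbhs_left_gt |].
  by near: s; exact: nbhs_left_lt.
have surj y : e < y -> exists2 t, 0 < t < S & p t = y.
  move=> ey.
  have [t1 /andP[t10 t1S] pt1] : exists2 t, 0 < t < S & y < p t.
    near (0 : R)^'+ => t; exists t.
      by apply/andP; split; near: t; [exact: nbhs_right_gt | exact: nbhs_right_lt].
    by near: t; move/cvgryPgt : p0; apply.
  have [t2 /andP[t20 t2S] pt2] : exists2 t, 0 < t < S & p t < y.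
    near S^'- => t; exists t.
      by apply/andP; split; near: t; [exact: nbhs_left_gt | exact: nbhs_left_lt].
    near: t; exact: (cvgr_lt e).
  have t12 : t1 < t2.
    rewrite ltNge le_eqVlt; apply/negP => /orP[/eqP E|h].
      by move: (lt_trans pt2 pt1); rewrite E ltxx.
    by have := decr _ _ t20 h t1S; rewrite ltNge (ltW (lt_trans pt2 pt1)).
  have [| |t] := @IVT _ p t1 t2 y (ltW t12).
  - apply: continuous_in_subspaceT => t; rewrite inE /= in_itv /= => /andP[a b].
    by apply: cp; rewrite (lt_le_trans t10 a) (le_lt_trans b t2S).
  - by rewrite ge_min le_max (ltW pt2) (ltW pt1) orbT.
  - rewrite in_itv /= => /andP[a b] <-; exists t => //.
    by rewrite (lt_le_trans t10 a) (le_lt_trans b t2S).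
(* The default [0] is returned only for levels that [p] does not attain on []0, S[]. *)
pose T (y : R) : R := xget 0 [set t | 0 < t < S /\ p t = y].
have TP y : e < y -> 0 < T y < S /\ p (T y) = y.
  move=> /surj[t tS pt]; rewrite /T; case: xgetP => [s -> //|/(_ t)].
  by case.
have lt1 t y : 0 < t < S -> e < y -> y < p t -> t < T y.
  move=> /andP[t0 tS] /TP[/andP[T0 TS] pT] ypt.
  rewrite ltNge le_eqVlt; apply/negP => /orP[/eqP E|h].
    by move: ypt; rewrite -E pT ltxx.
  by have := decr _ _ T0 h tS; rewrite pT ltNge (ltW ypt).
have lt2 t y : 0 < t < S -> p t < y -> T y < t.
  move=> /[dup] tS' /andP[t0 tS] pty; have [/andP[T0 TS] pT] := TP y (lt_trans (pge t tS') pty).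
  rewrite ltNge le_eqVlt; apply/negP => /orP[/eqP E|h].
    by move: pty; rewrite E pT ltxx.
  by have := decr _ _ t0 h TS; rewrite pT ltNge (ltW pty).
exists T; split => // y ey.
have [TS pT] := TP y ey; have [T0 T1] := andP TS.
rewrite -{1}pT; apply: is_derive_inverse.
- near=> t.
  have tS : 0 < t < S.
    by apply/andP; split; near: t; [exact: lt_nbhsr | exact: lt_nbhsl].
  have [/andP[a b] c] := TP (p t) (pge t tS); have [t0 tS'] := andP tS.
  apply/eqP; rewrite eq_le !leNgt; apply/andP; split; apply/negP => h.
    by have := decr _ _ t0 h b; rewrite c ltxx.
  by have := decr _ _ a h tS'; rewrite c ltxx.
- near=> t; apply: cp; apply/andP; split; near: t; [exact: lt_nbhsr | exact: lt_nbhsl].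
- exact: dp.
- by rewrite lt_eqF// q0.
Unshelve. all: by end_near. Qed.

(** Along the flow [dt = dp / q] with [q = - sqrt(4 p^3 - 32/27)]. With levels parametrized by
    [isog r], the function [- 2 sqrt 2 T(isog r)] is a primitive of the Beta integrand, rising from
    [- 2 sqrt 2 S] at [0] to [0] at infinity. *)
Lemma descent_time_Beta_e (R : realType) (S : R) (p q : R -> R) :
  0 < S ->
  (forall t : R, 0 < t < S -> is_derive t 1 p (q t)) ->
  (forall t : R, 0 < t < S -> q t < 0) ->
  (forall t : R, 0 < t < S -> q t ^+ 2 = 4 * p t ^+ 3 - 32 / 27) ->
  p t @[t --> S^'-] --> (2 / 3 : R) -> p t @[t --> 0^'+] --> +oo ->
  Beta_e 3^-1 2^-1 = (2 * Num.sqrt 2 * S)%:E.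
Proof.
move=> S0 dp q0 pq pS p0.
have [T [pgt TP dT [lt1 lt2]]] := descent_time S0 dp q0 pS p0.
have s2 : 0 < Num.sqrt 2 :> R by rewrite sqrtr_gt0.
pose k : R := - (2 * Num.sqrt 2).
pose F (r : R) : R := k * T (isog r).
have T0 : T (isog r) @[r --> 0^'+] --> S.
  apply/cvgrPdist_lt => d d0.
  (* A comparison time within [d] of [S]; the maximum with [S / 2] keeps it positive when [d] is
     large. *)
  have tS : 0 < Num.max (S / 2) (S - d / 2) < S.
    by rewrite lt_max gt_max; apply/and3P; split; [apply/orP; left | |]; lra.
  near=> r.
  have r0 : 0 < r by near: r; exact: nbhs_right_gt.
  have [/andP[a b] _] := TP _ (isog_gt r0).
  have : Num.max (S / 2) (S - d / 2) < T (isog r).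
    apply: lt1 => //; first exact: isog_gt.
    by near: r; apply: (cvgr_lt _ (@isog_cvg0 R)); exact: pgt.
  by rewrite gt_max ger0_norm ?subr_ge0 1?ltW// => /andP[_ h]; lra.
have Ty : T (isog r) @[r --> +oo] --> 0.
  apply/cvgrPdist_lt => d d0.
  have tS : 0 < Num.min (S / 2) (d / 2) < S.
    by rewrite gt_min lt_min -andbA; apply/and3P; split; [| |apply/orP; left]; lra.
  near=> r.
  have r0 : 0 < r by near: r; exact: nbhs_pinfty_gt.
  have [/andP[a b] _] := TP _ (isog_gt r0).
  have : T (isog r) < Num.min (S / 2) (d / 2).
    apply: lt2 => //.
    by near: r; have /cvgryPgt := @isog_cvgy R; apply.
  by rewrite lt_min sub0r normrN ger0_norm 1?ltW// => /andP[_ h]; lra.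
rewrite /Beta_e.
have -> : 2 * Num.sqrt 2 * S = k * 0 - k * S by rewrite /k; ring.
pose f (r : R) : R := r `^ (2^-1 - 1) * (1 + r) `^ (- (3^-1 + 2^-1)).
have cf (r : R) : 0 < r -> {for r, continuous f}.
  move=> r0; apply: cvgM; first exact: continuous_powR.
  by apply: continuous_powR_1D; exact: ltW.
have f0 (r : R) : 0 < r -> 0 <= f r.
  by move=> r0; rewrite mulr_ge0 ?powR_ge0.
have dF (r : R) : 0 < r -> is_derive r 1 F (f r).
  move=> r0; have r10 : 0 < 1 + r by rewrite ltr_wpDl.
  have gr := isog_gt r0; have [TS pT] := TP _ gr.
  have dF := is_deriveM (is_derive_cst k r 1)
    (is_derive1_comp (dT _ gr) (isog_derive r0)).
  apply: (is_derive_eq dF); rewrite /GRing.scale /f /= mulr0 addr0.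
  pose Q := (9 + 8 * r) * (4 * Num.sqrt 2 / 27) * (r `^ 2^-1 * ((1 + r) `^ 6^-1) ^- 3).
  have A0 : 0 < r `^ 2^-1 by rewrite powR_gt0.
  have [u0 E _ w8 w5] := powR_sixth r10.
  have Q0 : 0 < Q.
    by rewrite /Q !mulr_gt0 ?invr_gt0 ?exprn_gt0//; lra.
  (* The squares agree by the curve equation, and the flow descends, which selects the negative
     root. *)
  have qQ : q (T (isog r)) = - Q.
    have : (- q (T (isog r))) ^+ 2 = Q ^+ 2.
      by rewrite sqrrN pq// pT isog_sqr.
    move/eqP; rewrite eqrXn2 ?oppr_ge0 ?(ltW Q0) ?(ltW (q0 _ TS))// => /eqP <-.
    by rewrite opprK.
  have Am : r `^ (2^-1 - 1) = (r `^ 2^-1)^-1.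
    by rewrite -powRN; congr (_ `^ _); field.
  rewrite qQ w8 w5 Am /k /Q.
  have r9 : 0 < 9 + 8 * r by lra.
  by field; rewrite !gt_eqF.
have Fl0 : F r @[r --> 0^'+] --> k * S by apply: cvgMr.
have Fl1 : F r @[r --> +oo] --> k * 0 by apply: cvgMr.
exact: (integral_0y_FTC cf f0 dF Fl0 Fl1).
Unshelve. all: by end_near. Qed.

(** The cofactor of [y - x] in [y^3 - x^3] is nonnegative and vanishes only at the origin, since
    four times it is [(2 x + y)^2 + 3 y^2]. *)
Lemma ler_cube (R : realDomainType) (x y : R) : (x ^+ 3 <= y ^+ 3) = (x <= y).
Proof.
have q0 : 0 <= x ^+ 2 + x * y + y ^+ 2.
  rewrite -(pmulr_rge0 _ (ltr0n R 4)).
  have -> : 4%:R * (x ^+ 2 + x * y + y ^+ 2) = (2%:R * x + y) ^+ 2 + y ^+ 2 *+ 3 by ring.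
  by rewrite addr_ge0 ?mulrn_wge0 ?sqr_ge0.
have yx : y ^+ 3 - x ^+ 3 = (y - x) * (x ^+ 2 + x * y + y ^+ 2) by ring.
apply/idP/idP => [|xy]; last by rewrite -subr_ge0 yx mulr_ge0// subr_ge0.
apply: contraTT; rewrite -!ltNge => ltyx.
rewrite -subr_lt0 yx nmulr_rlt0 ?subr_lt0// lt_def q0 andbT.
apply/eqP => E.
have : (2%:R * x + y) ^+ 2 + y ^+ 2 *+ 3 = 0.
  by rewrite -(mulr0 4%:R) -E; ring.
move/eqP; rewrite paddr_eq0 ?mulrn_wge0 ?sqr_ge0// => /andP[+ /eqP y2].
have y0 : y = 0 by apply/eqP; move/eqP: y2; rewrite mulrn_eq0 /= sqrf_eq0.
rewrite y0 addr0 sqrf_eq0 mulf_eq0 pnatr_eq0 /= => /eqP x0.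
by move: ltyx; rewrite x0 y0 ltxx.
Qed.

(** Before [S] the flow is real, so [a / c] and [1 / c] are [wp] and [wp'] there and satisfy the
    real equations of [descent_time_Beta_e]. Continuity of [wp] at [S] supplies the endpoint. *)
Lemma flow_Beta_e (R : realType) (Om : R) (G : set R) (a b c d x y : R -> R) :
  real_axis_flow (32 / 27) Om G a b c d x y ->
  exists S, [/\ 0 < S < Om, ~ G S, x S = 2 / 3, y S = 0 &
    Beta_e 3^-1 2^-1 = (2 * Num.sqrt 2 * S)%:E].
Proof.
move=> F; have [S [SOm GS GltS cneg]] := flow_first_zero F.
have [S0 SltOm] := andP SOm.
have inOm t : 0 < t < S -> 0 < t < Om.
  by move=> /andP[-> tS]; rewrite (lt_trans tS).
have inG t : 0 < t < S -> [/\ G t, b t = 0 & d t = 0].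
  by move=> /andP[t0 tS]; apply: GltS; rewrite ltW.
pose p (t : R) : R := a t / c t.
pose q (t : R) : R := (c t)^-1.
have c0 t : 0 < t < S -> c t != 0 by move=> /cneg; rewrite lt_def eq_sym => /andP[].
have cubic t : 0 < t < S -> c t = 4 * a t ^+ 3 - 32 / 27 * c t ^+ 3.
  by move=> /inG[Gt bt dt]; exact: (flow_cubic F).
have dp (t : R) : 0 < t < S -> is_derive t 1 p (q t).
  move=> tS; have [Gt bt dt] := inG t tS; have ct := c0 t tS.
  have [da _ dc _] := flow_ode F (inOm t tS) Gt.
  have dV : is_derive t 1 (fun s => (c s)^-1) (- (c t) ^- 2 * (- 6 * (a t ^+ 2 - b t ^+ 2))).
    exact: is_deriveV.
  apply: (is_derive_eq (is_deriveM da dV)); rewrite /GRing.scale /= bt dt /q.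
  have E : 12 * a t ^+ 3 = 3 * c t + 32 / 9 * c t ^+ 3 by have := cubic t tS; lra.
  have -> : a t * (- (c t) ^- 2 * (- 6 * (a t ^+ 2 - 0 ^+ 2))) =
            (12 * a t ^+ 3) / (2 * c t ^+ 2) by field.
  by rewrite E; field.
have q0 (t : R) : 0 < t < S -> q t < 0 by move=> /cneg; rewrite /q invr_lt0.
have pq (t : R) : 0 < t < S -> q t ^+ 2 = 4 * p t ^+ 3 - 32 / 27.
  move=> tS; have ct := c0 t tS.
  have -> : q t ^+ 2 = c t / c t ^+ 3 by rewrite /q; field.
  by rewrite {1}(cubic t tS) /p; field.
have xp t : 0 < t < S -> x t = p t /\ y t = 0.
  by move=> tS; have [Gt bt dt] := inG t tS; exact: (flow_affine F (inOm t tS)).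
have nearS : \forall t \near S^'-, 0 < t < S.
  by near=> t; apply/andP; split; near: t; [exact: nbhs_left_gt | exact: nbhs_left_lt].
have [cx cy crit] := flow_crit F SOm GS.
have yS : y S = 0.
  have h : y t @[t --> S^'-] --> y S by apply: cvg_at_left_filter; exact: cy.
  have h0 : y t @[t --> S^'-] --> 0.
    by apply: cvg_near_cst; near=> t; rewrite (xp t _).2//; near: t.
  by apply: (cvg_unique _ h h0).
have xS : x S = 2 / 3.
  have E : x S ^+ 3 = (2 / 3) ^+ 3.
    by apply: (@mulfI _ 4) => //; rewrite crit//; field.
  by apply/eqP; rewrite eq_le -(ler_cube (x S)) -(ler_cube (2 / 3)) E lexx.
have pS : p t @[t --> S^'-] --> (2 / 3 : R).
  rewrite -xS; have h : x t @[t --> S^'-] --> x S by apply: cvg_at_left_filter; exact: cx.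
  apply: cvg_trans h; apply: near_eq_cvg; near=> t.
  by rewrite (xp t _).1//; near: t.
have p0 : p t @[t --> 0^'+] --> +oo.
  apply/cvgryPge => A; pose M := `|A| + 1.
  have M1 : 1 <= M by rewrite /M lerDr.
  have M0 : 0 < M by exact: lt_le_trans M1.
  have [G0 _ _ c00 _] := flow_start F.
  have [_ _ cc _] := flow_cont F G0.
  have cc0 : c t @[t --> 0^'+] --> 0.
    by rewrite -{2}c00; apply: cvg_at_right_filter; exact: cc.
  (* Below this threshold for [|c|], [q^2 >= 4 M^4 >= 4 M^3], and the cubic forces [p >= M]. *)
  have k0 : 0 < (2 * M ^+ 2)^-1 by rewrite invr_gt0 mulr_gt0// exprn_gt0.
  near=> t.
  have tS : 0 < t < S.
    by apply/andP; split; near: t; [exact: nbhs_right_gt | exact: nbhs_right_lt].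
  have ct : `|c t| < (2 * M ^+ 2)^-1 by near: t; exact: (cvgr0_norm_lt _ cc0).
  have MA : A <= M by rewrite (le_trans (ler_norm A))// lerDl.
  apply: (le_trans MA); rewrite -ler_cube.
  have : (2 * M ^+ 2) ^+ 2 <= q t ^+ 2.
    rewrite -[leRHS]real_normK ?num_real// lerXn2r ?nnegrE ?normr_ge0//.
      by rewrite mulr_ge0// sqr_ge0.
    by rewrite /q normfV -[leLHS]invrK lef_pV2 ?posrE ?normr_gt0 ?c0// ltW.
  rewrite pq//.
  have : M ^+ 3 <= M ^+ 4 by rewrite ler_weXn2l.
  rewrite exprMn -exprM => h1 h2; lra.
by exists S; split => //; exact: (descent_time_Beta_e S0 dp q0 pq pS p0).
Unshelve. all: by end_near. Qed.

Lemma proj_eq_refl (R : realType) (P : 'rV[R[i]]_3) : proj_eq P P.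
Proof. by exists 1; [exact: oner_neq0 | rewrite scale1r]. Qed.

(** The half-axes have first zeros [S1] and [- S2], and [S1 = S2] since both are given by the same
    Beta integral. The Weierstrass map takes the value [(2/3 : 0 : 1)] at both, so [S1 + S2] is a
    lattice point. *)
Lemma real_period_Beta_e (R : realType) (Om : R) :
  is_real_period 0 (32 / 27) Om ->
  Beta_e 3^-1 2^-1 = (Num.sqrt 2 * Om)%:E.
Proof.
move=> [L [HL Om0 [w' LE]]].
have n1 : (-1) * (-1) = 1 :> R by rewrite mulrNN mulr1.
have [S1 [S1Om G1 x1 y1 B1]] := flow_Beta_e (wmap_flow HL Om0 LE (mulr1 1)).
have [S2 [S2Om G2 x2 y2 B2]] := flow_Beta_e (wmap_flow HL Om0 LE n1).
have s20 : 2 * Num.sqrt 2 != 0 :> R by rewrite mulf_neq0// sqrtr_eq0 -ltNge.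
have S12 : S1 = S2 by apply: (mulfI s20); apply: EFin_inj; rewrite -B1 -B2.
have mapE z : wmap_coord L 1 z = 0 ->
    weierstrass_map L z = triple (weierstrass_p L z) 0 1.
  move=> z1.
  have zL : ~ L z.
    by move=> /wmap_coord_in[_ E _]; move: z1; rewrite E => /eqP; rewrite oner_eq0.
  have [_ E _] := wmap_coord_out zL.
  by rewrite /weierstrass_map (memNset zL) -E z1.
move/negP: G1 => /=; rewrite negbK => /eqP z1.
move/negP: G2 => /=; rewrite negbK => /eqP z2.
rewrite mul1r in x1 y1 z1.
have wE : weierstrass_map L (S1)%:C%C = weierstrass_map L (-1 * S2)%:C%C.
  rewrite (mapE _ z1) (mapE _ z2).
  by rewrite (real_eq_complex y1) (real_eq_complex y2) x1 x2.
have : L (S1%:C%C - (-1 * S2)%:C%C).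
  by have [_ _ inj _ _] := HL; apply/inj; rewrite wE; exact: proj_eq_refl.
rewrite -rmorphB LE int_span_real; last by rewrite -LE; case: HL.
move=> [m]; rewrite mulN1r opprK -S12 => E.
have [a b] := andP S1Om.
have m0 : 0 < m by rewrite -(ltr0z R) -(pmulr_lgt0 _ Om0) -E addr_gt0.
(* [S1 + S2] is a multiple of [Om] strictly between [0] and [2 Om], hence [Om] itself. *)
have m2 : m < 2.
  by rewrite -(ltr_int R) -(ltr_pM2r Om0) -E; lra.
have m1 : m = 1 by lia.
by rewrite B1; congr (_%:E); rewrite m1 mul1r in E; rewrite -E; ring.
Qed.

(** * The depressed cubic and the two identities *)

Lemma GammaE (R : realType) (x : R) : 0 < x -> Gamma x = fine (Gamma_e x).
Proof. by move=> x0; rewrite /Gamma x0 big_ord0 divr1 addr0. Qed.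

(** The shift by [1/3] gives [(y - 2/3) (y^2 + 2/3 y + 4/9) = y^3 - 8/27]. Evaluation at [0] and [1]
    suffices to read off [g3] and [g2]. *)
Lemma E_third_depressed (R : realType) (g2 g3 : R) :
  4 *: (E_third R \Po ('X - ((E_third R)`_2 / 3)%:P)) = 4 *: 'X^3 - g2 *: 'X - g3%:P ->
  g2 = 0 /\ g3 = 32 / 27.
Proof.
have -> : (E_third R)`_2 = -1.
  rewrite /E_third mulrBl !mul1r mulrDr.
  by rewrite !(coefB, coefD, coefXM, coefMC, coefXn, coefX, coefC) /=; ring.
move=> E.
have H y : 4 * ((y + 3^-1 - 1) * ((y + 3^-1) ^+ 2 + 1 / 3)) = 4 * y ^+ 3 - g2 * y - g3.
  have := congr1 (fun p => p.[y]) E; rewrite /E_third.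
  by rewrite !(hornerE, horner_comp) /= => <-; field.
have H0 := H 0; have H1 := H 1; split.
  by move: H0 H1; rewrite !expr0n /=; lra.
by move: H0; rewrite !expr0n /=; lra.
Qed.

Theorem corollary2p2 (R : realType) (Omega : R)
  (hOmega : is_real_period_monic (E_third R) Omega) :
  2 * Num.sqrt 2 / (3 * pi) * Omega = binomR (1 / 3) (1 / 2) /\
  Num.sqrt 2 * Omega = Gamma (1 / 3) * Gamma (1 / 2) / Gamma (5 / 6).
Proof.
have [g2 [g3 [/E_third_depressed[-> ->] /real_period_Beta_e BE]]] := hOmega.
have h3 : 0 < 3^-1 :> R by rewrite invr_gt0.
have h2 : 0 < 2^-1 :> R by rewrite invr_gt0.
have h56 : 0 < 3^-1 + 2^-1 :> R by rewrite addr_gt0.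
have l3 : 3^-1 <= 1 :> R by lra.
have l2 : 2^-1 <= 1 :> R by lra.
have l56 : 3^-1 + 2^-1 <= 1 :> R by lra.
have f3 := Gamma_e_fin h3 l3; have f2 := Gamma_e_fin h2 l2.
have f56 := Gamma_e_fin h56 l56.
have GB : Gamma 3^-1 * Gamma 2^-1 = Gamma (3^-1 + 2^-1) * (Num.sqrt 2 * Omega) :> R.
  rewrite (GammaE h3) (GammaE h2) (GammaE h56) -(fineM f3 f2) Gamma_e_Beta_e BE.
  by rewrite fineM.
have Gpi : Gamma 2^-1 ^+ 2 = pi :> R.
  rewrite (GammaE h2) expr2 -(fineM f2 f2) Gamma_e_Beta_e Beta_e_half.
  have -> : 2^-1 + 2^-1 = 1 :> R by field.
  by rewrite Gamma_e_1 mul1e.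
have succ (x : R) : 0 < x -> Gamma_e x \is a fin_num -> Gamma (x + 1) = x * Gamma x.
  move=> x0 fx; rewrite (GammaE x0) (GammaE (addr_gt0 x0 ltr01)) (Gamma_e_succ x0).
  by rewrite fineM.
have pos (x : R) : 0 < x -> x <= 1 -> Gamma x != 0.
  move=> x0 x1; rewrite (GammaE x0) (fine_eq0 (Gamma_e_fin x0 x1)).
  by rewrite (gt_eqF (Gamma_e_gt0 x1)).
have p2 := pos _ h2 l2; have p56 := pos _ h56 l56.
have -> : 5 / 6 = 3^-1 + 2^-1 :> R by field.
(* The binomial is [Gamma(4/3) / (Gamma(3/2) Gamma(5/6))]. The functional equation brings out [2/3],
   and eliminating [Gamma(1/3)] leaves [Gamma(1/2)^2 = pi] in the denominator. *)
rewrite /binomR !div1r (_ : 3^-1 - 2^-1 + 1 = 3^-1 + 2^-1); last by field.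
rewrite !succ// GB; split; last by field.
have -> : Gamma 3^-1 = Gamma (3^-1 + 2^-1) * (Num.sqrt 2 * Omega) / Gamma 2^-1 :> R.
  by rewrite -GB; field.
by rewrite -Gpi; field; rewrite p2 p56.
Qed.
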